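(* Let $d\ge2$, let $D\in\mathbb{C}[t]$ be squarefree of degree $2d$, let $(A,B)$ be a solution of degree $n$ of the Pell–Abel equation $A^2-DB^2=1$, and let $G_A\le S_{2n}$ be the monodromy group of $\phi_A=A^2$. Then for every positive integer $m$ with $m\mid n$ and $n/m\ge d$, the solution $(A,B)$ is the $m$-th power of another solution of the same Pell–Abel equation if and only if $G_A$ is $2m$-imprimitive.
   Context: Pell–Abel equation: for $D\in\mathbb{C}[t]$, solutions are pairs $(A,B)\in\mathbb{C}[t]^2$ with $A^2-DB^2=1$ and $B\neq0$; the degree of a solution is $\deg A$. A solution $(A,B)$ is the $m$-th power of a solution $(A',B')$ if $A+\sqrt{D}B=\pm(A'\pm\sqrt{D}B')^m$ for some choice of signs. Monodromy group: for the polynomial map $\phi_A=A^2:\mathbb{P}^1(\mathbb{C})\to\mathbb{P}^1(\mathbb{C})$ of degree $2n$, choose a non-branch base point $q$, label $\phi_A^{-1}(q)$ by $\{1,\dots,2n\}$; lifting loops based at $q$ gives a homomorphism $\pi_1(\mathbb{P}^1\setminus\{\text{branch points}\},q)\to S_{2n}$, whose image $G_A$ (a transitive subgroup, well defined up to conjugation in $S_{2n}$) is the monodromy group. For $\ell\mid 2n$, an $\ell$-partition of $\{1,\dots,2n\}$ is a partition into $\ell$ subsets each of cardinality $2n/\ell$; a subgroup $G\le S_{2n}$ is $\ell$-imprimitive if some $\ell$-partition is preserved by $G$ (every element of $G$ maps each block onto a block). *)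

(* Defs.v *)
From mathcomp Require Import all_boot all_order all_algebra all_fingroup.
From mathcomp Require Import reals.
From mathcomp Require Export complex.
Set Implicit Arguments. Unset Strict Implicit. Unset Printing Implicit Defensive.
Import GRing.Theory Num.Theory.
Local Open Scope ring_scope.

Definition sqfree (F : idomainType) (p : {poly F}) : Prop :=
  forall q : {poly F}, q * q %| p -> (size q <= 1)%N.

Definition is_pell_sol (F : comNzRingType) (D A B : {poly F}) : Prop :=
  A ^+ 2 - D * B ^+ 2 = 1 /\ B != 0.

(* multiplication in C[t][sqrt D] on pairs (a,b) <-> a + sqrt(D) b *)
Definition pell_mul (F : comNzRingType) (D : {poly F})
  (x y : {poly F} * {poly F}) : {poly F} * {poly F} :=
  (x.1 * y.1 + D * x.2 * y.2, x.1 * y.2 + x.2 * y.1).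

Definition pell_pow (F : comNzRingType) (D : {poly F})
  (x : {poly F} * {poly F}) (m : nat) : {poly F} * {poly F} :=
  iter m (pell_mul D x) (1, 0).

Definition is_pell_power (F : comNzRingType) (D A B : {poly F}) (m : nat) : Prop :=
  exists A' B' : {poly F}, is_pell_sol D A' B' /\
    exists s1 s2 : bool,
      let P := pell_pow D (A', (-1) ^+ s2 * B') m in
      (A, B) = ((-1) ^+ s1 * P.1, (-1) ^+ s1 * P.2).

Definition contin01 (R : realType) (f : R -> R[i]) : Prop :=
  forall t : R, 0 <= t <= 1 -> forall e : R, 0 < e ->
    exists del : R, 0 < del /\
      forall s : R, 0 <= s <= 1 -> `|s - t| < del -> `|f s - f t| < (e%:C)%C.

Definition crit_val (R : realType) (P : {poly R[i]}) (w : R[i]) : Prop :=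
  exists c : R[i], (P^`()).[c] = 0 /\ P.[c] = w.

Definition fibre_labelling (R : realType) (P : {poly R[i]}) (q : R[i]) (k : nat)
  (lab : 'I_k -> R[i]) : Prop :=
  injective lab /\ (forall i, P.[lab i] = q) /\
  (forall z, P.[z] = q -> exists i, lab i = z).

Definition monodromy_perm (R : realType) (P : {poly R[i]}) (q : R[i]) (k : nat)
  (lab : 'I_k -> R[i]) (s : 'S_k) : Prop :=
  exists gamma : R -> R[i],
    [/\ contin01 gamma, gamma 0 = q, gamma 1 = q,
        (forall t : R, 0 <= t <= 1 -> ~ crit_val P (gamma t)) &
        forall i : 'I_k, exists lift : R -> R[i],
          [/\ contin01 lift,
              (forall t : R, 0 <= t <= 1 -> P.[lift t] = gamma t),
              lift 0 = lab i & lift 1 = lab (s i)]].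

Definition imprimitive (k l : nat) (G : 'S_k -> Prop) : Prop :=
  (l %| k)%N /\
  exists Pt : {set {set 'I_k}},
    [/\ partition Pt [set: 'I_k], #|Pt| = l,
        (forall Bl, Bl \in Pt -> #|Bl| = (k %/ l)%N) &
        forall s, G s -> forall Bl, Bl \in Pt -> [set s x | x in Bl] \in Pt].

(* Main.v *)
(** If [A ^+ 2 = h \Po g], the fibres of [g] over a base point are blocks, by
    uniqueness of path lifting.  Conversely, given blocks of size [k], the product
    of [x0 - z'] over the block of [z] is single valued and holomorphic off the
    critical fibres and grows at most like [|z| ^ k]; by Liouville it is a
    polynomial [g] of degree [k], and [A ^+ 2], being constant on the fibres of [g],
    is a polynomial [h] in [g].  Counting critical points then shows that [h] is
    the square of a Chebyshev polynomial up to an affine change of variable, and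
    the same change of variable turns [g] into the wanted solution.

    Liouville's theorem is proved without integration: divided differences reduce
    it to a function [f] that is [O(1 / |z|)]; a power of [f] exceeding the number
    of exceptional points, times the polynomial vanishing at these points, extends
    continuously and tends to [0], while [|f| ^ 2 + e |z| ^ 2] has no local
    maximum for [e > 0]. *)
Require Import Defs.
From mathcomp Require Import all_boot all_order all_algebra all_fingroup.
From mathcomp Require Import separable.
From mathcomp Require Import boolp classical_sets reals topology normedtype derive.
From mathcomp Require Import complex.
From mathcomp Require Import zify ring lra.
Set Implicit Arguments. Unset Strict Implicit. Unset Printing Implicit Defensive.
Import Order.TTheory GRing.Theory Num.Theory.
Local Open Scope ring_scope.

(** * Pell-Abel equation and Chebyshev polynomials *)

(** The bound [d <= n %/ m] enters through one degree count. Let [K = n %/ m] be the degree of [g]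
    and [r] the number of roots of odd order of [h - 1]. As [A ^+ 2 - 1 = D * B ^+ 2] with [D]
    squarefree, these roots pull back under [g] to [D * b ^+ 2], so [r * K = 2 * d + 2 * deg b]. The
    factor [b] divides the derivative of [g], so [deg b < K] and [r < 4]; ramification of [h] itself
    gives [r >= 2], and [r] is even. The two points left can be moved to 1 and -1, which turns the
    condition on [h] into the Pell equation for ['X ^+ 2 - 1], where descent on the degree finds
    every solution. On the analytic side, functions built by choosing roots are known only
    pointwise. Expansions with a third-order remainder replace holomorphy: they survive sums,
    products and local inversion, and the maximum principle looks at nothing beyond second order. *)

Lemma size_compS (F : idomainType) (p q : {poly F}) (a b : nat) :
  size p = a.+1 -> size q = b.+2 -> size (p \Po q) = (a * b.+1).+1.
Proof.
move=> sp sq; have := size_comp_poly p q; rewrite sp sq /=.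
have : p \Po q != 0 by rewrite comp_poly_eq0 ?sq // -size_poly_gt0 sp.
by rewrite -size_poly_gt0; case: (size _) => //= s _ ->.
Qed.

Lemma size_derivS (F : numFieldType) (p : {poly F}) : size p^`() = (size p).-1.
Proof.
have [s1|s1] := leqP (size p) 1.
  by rewrite (size1_polyC s1) derivC size_poly0 size_polyC; case: (_ != 0).
apply: anti_leq; rewrite -ltnS prednK ?(ltnW s1) // lt_size_deriv ?andbT; last first.
  by rewrite -size_poly_gt0 (ltnW s1).
rewrite leqNgt; apply/negP => h.
have : p^`()`_((size p).-2) = 0.
  by apply: nth_default; rewrite -ltnS; case: (size p) s1 h => [|[|n]].
rewrite coef_deriv prednK; last by case: (size p) s1 => [|[|n]].
move/eqP; rewrite mulrn_eq0 -lead_coefE lead_coef_eq0 -size_poly_eq0.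
by case: (size p) s1 => [|[|n]].
Qed.

Lemma dvdp_deriv_sq (F : fieldType) (V S : {poly F}) : V ^+ 2 %| S -> V %| S^`().
Proof.
case/dvdpP=> E ->; rewrite expr2 mulrA derivM; apply: dvdp_add.
  exact: dvdp_mull.
by apply: dvdp_mulr; apply: dvdp_mull.
Qed.

(** [V] divides the derivative of the composite, which is [g^]()[times the derivative of the product
    taken at]g[. The]v[being distinct, the latter factor is coprime to]V[, so]V[divides]g^[()]:
    multiplicity comes only from critical points of [g]. *)
Lemma size_dvd_sq_comp (F : numFieldType) (s : seq F) (g E V : {poly F}) (k : nat) :
  uniq s -> size g = k.+2 ->
  (\prod_(v <- s) ('X - v%:P)) \Po g = E * V ^+ 2 -> (size V <= k.+1)%N.
Proof.
set S := \prod_(v <- s) _ => us sg eS.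
have dV2 : V ^+ 2 %| S \Po g by rewrite eS dvdp_mull.
have dV : V %| S \Po g by apply: dvdp_trans dV2; rewrite expr2 dvdp_mull.
have := dvdp_deriv_sq dV2; rewrite deriv_comp Gauss_dvdpr.
  move/dvdp_leq; rewrite size_derivS sg; apply.
  by rewrite -size_poly_gt0 size_derivS sg.
apply: (coprimep_dvdr dV); apply: coprimep_comp_poly.
by move: us; rewrite -separable_prod_XsubC separable_poly.unlock.
Qed.

(** Once the gcd of [Q] and [B] is divided out, what remains of [Q] is coprime to what remains of
    [B], so its square divides [D] and it is constant. *)
Lemma sqfree_sq_dvd (F : fieldType) (D Q B : {poly F}) :
  sqfree D -> Q != 0 -> B != 0 -> Q ^+ 2 %| D * B ^+ 2 -> Q %| B.
Proof.
move=> sD Q0 B0 dv.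
have G0 : gcdp Q B != 0 by rewrite gcdp_eq0 negb_and B0 orbT.
have := @coprimep_div_gcd _ Q B; rewrite B0 orbT => /(_ isT) cqb.
have eQ := divpK (dvdp_gcdl Q B); have eB := divpK (dvdp_gcdr Q B).
move: G0 cqb eQ eB (dvdp_gcdr Q B); move: (gcdp Q B) => G.
move: (Q %/ G) (B %/ G) => q b G0 cqb eQ eB GB; move: dv.
rewrite -eQ -{1}eB !exprMn [D * _]mulrA. rewrite dvdp_mul2r ?expf_neq0 //.
rewrite Gauss_dvdpl; last by apply: coprimep_expl; apply: coprimep_expr.
rewrite expr2 => /sD sz; apply: dvdp_trans GB.
move: eQ; rewrite (size1_polyC sz) mul_polyC => eQ.
rewrite dvdpZl //; apply: contraNneq Q0 => c0.
by rewrite -eQ c0 scale0r.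
Qed.

(** [s] lists the roots of odd multiplicity: a root met again leaves [s] and enters [Q]. A square
    root of the leading coefficient is absorbed by [Q]. *)
Lemma odd_part (F : numClosedFieldType) (p : {poly F}) : p != 0 ->
  exists s Q, [/\ uniq s, Q != 0 & p = (\prod_(v <- s) ('X - v%:P)) * Q ^+ 2].
Proof.
have [r ->] := closed_field_poly_normal p.
rewrite scaler_eq0 negb_or => /andP[c0 _].
have [b b2] : exists b : F, b ^+ 2 = lead_coef p.
  by exists (sqrtC (lead_coef p)); rewrite sqrtCK.
rewrite -b2 in c0 *; have b0 : b != 0 by apply: contraNneq c0 => ->; rewrite expr0n.
elim: r => [|v r [s [Q [us Q0 IH]]]].
  by exists [::], b%:P; rewrite polyC_eq0 !big_nil mul1r -polyC_exp alg_polyC.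
rewrite big_cons scalerAr IH; have [vs|vs] := boolP (v \in s).
  exists (rem v s), (Q * ('X - v%:P)); rewrite rem_uniq // mulf_neq0 ?polyXsubC_eq0 //.
  by split=> //; rewrite (big_rem v vs) /= exprMn expr2; ring.
by exists (v :: s), Q; rewrite /= vs us Q0 big_cons; split=> //; rewrite mulrA.
Qed.

(** * Chebyshev polynomials and the Pell equation for X^2 - 1 *)

Section Chebyshev.
Variable F : numFieldType.
Implicit Types (H U : {poly F}) (e : bool).

(** The powers of X + sqrt(X^2 - 1) or of its conjugate: the pair is (T_m, U_(m-1)) up to the sign
    of the second entry. *)
Definition cheb e := pell_pow ('X ^+ 2 - 1 : {poly F}) ('X, (-1) ^+ e).

Lemma chebS e m : cheb e m.+1 =
  ('X * (cheb e m).1 + ('X ^+ 2 - 1) * (-1) ^+ e * (cheb e m).2,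
   'X * (cheb e m).2 + (-1) ^+ e * (cheb e m).1).
Proof. by []. Qed.

(** Both components are followed together because each top coefficient is a sum of one from each;
    the sign [(-1) ^+ e] occurs squared, so the two terms agree and double instead of cancelling. *)
Lemma coef_cheb e m :
  [/\ forall i, (m.+1 < i)%N -> (cheb e m.+1).1`_i = 0,
      forall i, (m < i)%N -> (cheb e m.+1).2`_i = 0,
      (cheb e m.+1).1`_m.+1 = 2 ^+ m & (cheb e m.+1).2`_m = (-1) ^+ e * 2 ^+ m].
Proof.
elim: m => [|m [st su ct cu]].
  rewrite chebS /cheb /= mulr1 mulr0 addr0 mulr1 mulr0 add0r expr0 mulr1.
  split=> [[|[|i]] //||//|]; rewrite ?coefX //.
    by case=> // i _; case: e; rewrite ?expr0 ?expr1 ?coefN coef1 ?oppr0.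
  by case: e; rewrite ?expr0 ?expr1 ?coefN coef1.
have sgn (p : {poly F}) i : ((-1) ^+ e * p)`_i = (-1) ^+ e * p`_i.
  by case: (e); rewrite ?expr0 ?expr1 ?mul1r // !mulN1r coefN.
have c1 i : (cheb e m.+2).1`_i.+1 = (cheb e m.+1).1`_i +
    (-1) ^+ e * ((if (i == 0)%N then 0 else (cheb e m.+1).2`_i.-1) - (cheb e m.+1).2`_i.+1).
  rewrite chebS [_.1]/= coefD coefXM /=; congr (_ + _).
  have -> u : ('X ^+ 2 - 1) * (-1) ^+ e * u = (-1) ^+ e * ('X^2 * u - u) :> {poly F} by ring.
  by rewrite sgn coefB coefXnM; case: i => [|i] //=; rewrite subn2.
have c2 i : (cheb e m.+2).2`_i.+1 = (cheb e m.+1).2`_i + (-1) ^+ e * (cheb e m.+1).1`_i.+1.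
  by rewrite chebS [_.2]/= coefD coefXM /= sgn.
split=> [[//|i] hi|[//|i] hi||]; rewrite ?c1 ?c2.
- rewrite st // su; last by lia.
  by case: i hi => [|i] hi; rewrite /= ?subrr ?mulr0 ?addr0 // su ?subrr ?mulr0 ?addr0 //; lia.
- by rewrite su ?st ?mulr0 ?addr0 //; lia.
- rewrite ct /= cu su // subr0 mulrA -expr2 sqrr_sign mul1r.
  by rewrite exprS mulr_natl mulr2n.
- by rewrite cu ct exprS mulr_natl mulr2n mulrDr.
Qed.

Lemma size_cheb e m : size (cheb e m).1 = m.+1.
Proof.
case: m => [|m]; first by rewrite /cheb /= size_poly1.
have [st _ ct _] := coef_cheb e m; apply: anti_leq; apply/andP; split.
  by apply/leq_sizeP => i hi; apply: st.
by rewrite ltnNge; apply/negP => /leq_sizeP/(_ _ (leqnn _))/eqP; rewrite ct expf_eq0 pnatr_eq0 andbF.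
Qed.

(** X + sqrt(X^2 - 1) and its conjugate are inverse to each other, so a factor of the same sign
    raises the exponent and one of opposite sign lowers it. At exponent 0 the sign carries no
    information, so there [e] may change. *)
Lemma cheb_mul (f : bool) e m : exists e' m', cheb e' m' =
  ('X * (cheb e m).1 + ('X ^+ 2 - 1) * (-1) ^+ f * (cheb e m).2,
   'X * (cheb e m).2 + (-1) ^+ f * (cheb e m).1).
Proof.
have [->|nfe] := eqVneq f e; first by exists e, m.+1.
case: m => [|m]; first by exists f, 1%N.
exists e, m; have -> : f = ~~ e by case: f e nfe => [] [].
rewrite chebS /=; move: (cheb e m) => [t u] /=.
have -> : (-1) ^+ (~~ e) = - (-1) ^+ e :> {poly F} by case: e {nfe}; rewrite ?expr0 ?expr1 ?opprK.
have : ((-1) ^+ e : {poly F}) ^+ 2 = 1 by rewrite sqrr_sign.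
move: ((-1) ^+ e) => s s2; congr (_, _).
  transitivity (t * ('X ^+ 2 - ('X ^+ 2 - 1) * s ^+ 2)); last by ring.
  by rewrite s2; ring.
transitivity (u * ('X ^+ 2 - ('X ^+ 2 - 1) * s ^+ 2)); last by ring.
by rewrite s2; ring.
Qed.

(** Descent on the degree of [H]: multiplying the solution by a suitable one of the two fundamental
    units lowers it. A constant [H] forces [U = 0], by comparing degrees. *)
Lemma cheb_descent n H U : (size H <= n.+1)%N -> H ^+ 2 - ('X ^+ 2 - 1) * U ^+ 2 = 1 ->
  exists m (s e : bool), (H, U) = ((-1) ^+ s * (cheb e m).1, (-1) ^+ s * (cheb e m).2).
Proof.
elim: n H U => [|n IH] H U sH pe.
  exists 0%N; rewrite /cheb /=.
  have eq1 : ('X ^+ 2 - 1) * U ^+ 2 = H ^+ 2 - 1.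
    by have /eqP := pe; rewrite subr_eq => /eqP ->; ring.
  have [U0|U0] := eqVneq U 0.
    move: eq1; rewrite U0 expr0n mulr0 => /esym/eqP; rewrite subr_eq0 sqrf_eq1.
    by case/orP => /eqP ->; [exists false|exists true]; exists false;
      rewrite ?expr0 ?expr1 ?mulr1 ?mulr0.
  have sX : size ('X ^+ 2 - 1 : {poly F}) = 3 by rewrite -polyC1 size_XnsubC.
  have : (size ((('X ^+ 2 - 1) * U ^+ 2)%R : {poly F}) <= 1)%N.
    rewrite eq1 (size1_polyC sH) -polyC_exp -polyCB; exact: size_polyC_leq1.
  rewrite size_mul ?expf_neq0 //; last by rewrite -size_poly_eq0 sX.
  by rewrite sX (polySpred (expf_neq0 2%N U0)).
have [sH'|sH'] := leqP (size H) n.+1; first exact: IH.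
have {sH sH'} sH : size H = n.+2 by apply: anti_leq; rewrite sH.
(* [G f] is the first component of the solution times X - (-1)^f sqrt(X^2 - 1). The two choices have
   sum [2 * 'X * H], of degree [n + 2], and by the equation product [H ^+ 2 + 'X ^+ 2 - 1], of
   degree at most [2 * n + 2]; hence one of them has degree at most [n]. *)
pose G (f : bool) := 'X * H - ('X ^+ 2 - 1) * (-1) ^+ f * U.
have [f sG] : exists f : bool, (size (G f) <= n.+1)%N.
  have GG : G true * G false = H ^+ 2 + ('X ^+ 2 - 1).
    apply/eqP; rewrite -subr_eq0 /G expr0 expr1; apply/eqP.
    transitivity (('X ^+ 2 - 1) * (H ^+ 2 - ('X ^+ 2 - 1) * U ^+ 2 - 1)); first by ring.
    by rewrite pe subrr mulr0.
  have sGG : (size ((G true * G false)%R : {poly F}) <= (n.*2).+3)%N.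
    rewrite GG; apply: leq_trans (size_polyD _ _) _; rewrite geq_max.
    have -> : size ('X ^+ 2 - 1 : {poly F}) = 3 by rewrite -polyC1 size_XnsubC.
    by apply/andP; split; [apply: leq_trans (size_poly_exp_leq _ _) _; rewrite sH; lia|lia].
  have sGs : size ((G true + G false)%R : {poly F}) = n.+3.
    have -> : G true + G false = 2%:P * ('X * H) by rewrite /G expr0 expr1 polyCMn; ring.
    rewrite mul_polyC size_scale ?pnatr_eq0 // size_mul ?polyX_eq0 ?size_polyX ?sH //.
    by rewrite -size_poly_eq0 sH.
  have := size_polyD (G true) (G false); rewrite sGs leq_max.
  have [G1|G1] := eqVneq (G true) 0; first by exists true; rewrite G1 size_poly0.
  have [G2|G2] := eqVneq (G false) 0; first by exists false; rewrite G2 size_poly0.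
  move: sGG; rewrite size_mul // => sGG /orP[] sl; [exists false|exists true].
    by move: sl sGG; move: (size _) (size _) => a b; lia.
  by move: sl sGG; move: (size _) (size _) => a b; lia.
have s2 : ((-1) ^+ f : {poly F}) ^+ 2 = 1 by rewrite sqrr_sign.
have [] := IH (G f) ('X * U - (-1) ^+ f * H) sG.
  rewrite -[RHS]pe /G; move: ((-1) ^+ f) s2 => s s2.
  transitivity ((H ^+ 2 - ('X ^+ 2 - 1) * U ^+ 2) * ('X ^+ 2 - ('X ^+ 2 - 1) * s ^+ 2)).
    by ring.
  by rewrite s2; ring.
move=> m [s [e [eG eU]]].
have [e' [m' E]] := cheb_mul f e m; exists m', s, e'; rewrite E /=; congr (_, _).
  transitivity ('X * G f + ('X ^+ 2 - 1) * (-1) ^+ f * ('X * U - (-1) ^+ f * H)).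
    rewrite /G; move: ((-1) ^+ f) s2 => t t2.
    transitivity (('X ^+ 2 - ('X ^+ 2 - 1) * t ^+ 2) * H); last by ring.
    by rewrite t2; ring.
  by rewrite eG eU; ring.
transitivity ('X * ('X * U - (-1) ^+ f * H) + (-1) ^+ f * G f).
  rewrite /G; move: ((-1) ^+ f) s2 => t t2.
  transitivity (('X ^+ 2 - ('X ^+ 2 - 1) * t ^+ 2) * U); last by ring.
  by rewrite t2; ring.
by rewrite eG eU; ring.
Qed.

End Chebyshev.

(** Since [A ^+ 2 - 1 = D * B ^+ 2], substituting [A] for X sends sqrt(X^2 - 1) to [B] sqrt(D), so
    the powers of any solution are Chebyshev polynomials in [A]. *)
Lemma pell_pow_comp (F : numFieldType) (D A B : {poly F}) (e : bool) m :
  A ^+ 2 - D * B ^+ 2 = 1 ->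
  pell_pow D (A, (-1) ^+ e * B) m = ((cheb F e m).1 \Po A, ((cheb F e m).2 \Po A) * B).
Proof.
move=> pe; elim: m => [|m IH]; first by rewrite /cheb /= rmorph1 rmorph0 mul0r.
rewrite chebS /= IH /pell_mul /= !comp_polyD !comp_polyM comp_polyX rmorphB rmorphXn /= comp_polyX.
rewrite rmorph1 rmorph_sign.
have -> : A ^+ 2 - 1 = D * B ^+ 2 by have /eqP := pe; rewrite subr_eq => /eqP ->; ring.
by congr (_, _); ring.
Qed.

Lemma odd_part_size (F : idomainType) (s : seq F) (Q : {poly F}) : Q != 0 ->
  size (((\prod_(v <- s) ('X - v%:P)) * Q ^+ 2)%R : {poly F}) = (size s + (size Q).-1.*2).+1.
Proof.
move=> Q0; rewrite size_mul ?(expf_neq0 _ Q0) //; last by rewrite monic_neq0 ?monic_prod_XsubC.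
rewrite size_prod_XsubC expr2 size_mul //.
by move: Q0; rewrite -size_poly_gt0; case: (size Q) => //= n _; lia.
Qed.

(* Only two points of the line can carry branch points of odd order of [h] that
   [g] does not absorb, since [g] has fewer than [size g] critical points; this
   leaves [h] no choice but to be the square of a Chebyshev polynomial. *)
Lemma pell_power_of_comp (F : numClosedFieldType) (d m k : nat) (D A B g h : {poly F}) :
  sqfree D -> size D = (2 * d).+1 -> is_pell_sol D A B ->
  (0 < m)%N -> (1 < k)%N -> (d <= k)%N -> size g = k.+1 -> size h = (2 * m).+1 ->
  A ^+ 2 = h \Po g -> is_pell_power D A B m.
Proof.
move=> sqD sD [pe B0] m0 k1 dk sg sh Ah.
case: k => [//|k] in k1 dk sg *.
have h0 : h != 0 by rewrite -size_poly_gt0 sh.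
have compg0 p : p != 0 -> p \Po g != 0 by rewrite comp_poly_eq0 // sg; lia.
have [s0 [Q0 [us0 Q00 eh]]] := odd_part h0.
have sz0 := odd_part_size s0 Q00; rewrite -eh sh in sz0.
have [T eT] : exists T, A = T * (Q0 \Po g).
  apply/dvdpP; rewrite -(@dvdp_pexp2r _ _ _ 2) // Ah eh comp_polyM [_ ^+ 2 \Po _]rmorphXn /=.
  exact: dvdp_mull.
have T2 : (\prod_(v <- s0) ('X - v%:P)) \Po g = 1 * T ^+ 2.
  apply: (mulIf (expf_neq0 2%N (compg0 _ Q00))); rewrite mul1r -exprMn -eT Ah eh comp_polyM.
  by rewrite [_ ^+ 2 \Po _]rmorphXn.
have sT := size_dvd_sq_comp us0 sg T2.
(* [T] has degree at most [k], so [size s0 * k.+1 <= 2 * k] leaves at most one odd root; the even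
   degree of [h] excludes exactly one. *)
have s00 : s0 = [::].
  have := congr1 (fun p : {poly F} => size p) T2; rewrite (@size_compS _ _ _ (size s0) k) ?size_prod_XsubC //.
  rewrite mul1r => e1; have := size_poly_exp_leq T 2; rewrite -e1 => e2.
  apply: size0nil.
    move: e2 sT sz0; move: (size T) (size Q0) (size s0) => a b [|[|c]] // e2 sT; first by lia.
    have : (c.+2 * k.+1 <= k * 2)%N by lia.
    by rewrite mulSn mulSn; lia.
have T1 : T ^+ 2 = 1 by move: T2; rewrite s00 big_nil rmorph1 mul1r.
pose H := T * Q0.
have Hg : H \Po g = A.
  rewrite /H comp_polyM eT; congr (_ * _).
  by move/eqP: T1; rewrite sqrf_eq1 => /orP[] /eqP ->; rewrite ?rmorphN rmorph1.
have hH : h = H ^+ 2 by rewrite exprMn T1 mul1r eh s00 big_nil mul1r.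
have sH : size H = m.+1.
  have H0 : H != 0 by apply: contraNneq h0; rewrite hH => ->; rewrite expr0n.
  have := @odd_part_size _ [::] _ H0; rewrite big_nil mul1r -hH sh.
  by move: H0; rewrite -size_poly_gt0; case: (size H) => //= n _; lia.
have hs1 : size (h - 1) = (2 * m).+1.
  by rewrite size_polyDl ?size_polyN ?size_poly1 sh //; lia.
have hm1 : h - 1 != 0 by rewrite -size_poly_gt0 hs1.
have [s1 [Q1 [us1 Q10 eh1]]] := odd_part hm1.
have sz1 := odd_part_size s1 Q10; rewrite -eh1 hs1 in sz1.
have dQ1 : Q1 ^+ 2 %| H ^+ 2 - 1 by rewrite -hH eh1 dvdp_mull.
have sQ1 : (size Q1 <= m)%N.
  have sH' : size H^`() = m by rewrite size_derivS sH.
  rewrite -sH'; apply: dvdp_leq; first by rewrite -size_poly_gt0 sH'.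
  have := dvdp_deriv_sq dQ1; rewrite derivB derivC subr0 expr2 derivM mulrC -mulr2n.
  rewrite -mulr_natl -polyCMn mul_polyC dvdpZr ?pnatr_eq0 // Gauss_dvdpr //.
  apply/coprimepP => r rQ rH; rewrite -size_poly_eq1 -dvdp1.
  have -> : 1 = H ^+ 2 - (H ^+ 2 - 1) :> {poly F} by ring.
  apply: dvdp_sub; first by rewrite expr2 dvdp_mull.
  by apply: dvdp_trans rQ _; apply: dvdp_trans dQ1; rewrite expr2 dvdp_mull.
have eD : ((\prod_(v <- s1) ('X - v%:P)) \Po g) * (Q1 \Po g) ^+ 2 = D * B ^+ 2.
  rewrite -rmorphXn -comp_polyM -eh1 rmorphB rmorph1 /= -Ah.
  by have /eqP := pe; rewrite subr_eq => /eqP ->; ring.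
have [b eb] : exists b, B = b * (Q1 \Po g).
  apply/dvdpP; apply: (sqfree_sq_dvd sqD) => //; first exact: compg0.
  by rewrite -eD dvdp_mull.
have b0 : b != 0 by apply: contraNneq B0; rewrite eb => ->; rewrite mul0r.
have {}eD : (\prod_(v <- s1) ('X - v%:P)) \Po g = D * b ^+ 2.
  by apply: (mulIf (expf_neq0 2%N (compg0 _ Q10))); rewrite eD eb exprMn mulrA.
have sb := size_dvd_sq_comp us1 sg eD.
have D0 : D != 0 by rewrite -size_poly_gt0 sD.
(* [size s1 * k.+1 = 2 * d + 2 * deg b] with [d <= k.+1] and [deg b <= k], so fewer than four odd
   roots; the count is even and at least two. *)
have s12 : size s1 = 2%N.
  have := congr1 (fun p : {poly F} => size p) eD; rewrite (@size_compS _ _ _ (size s1) k) ?size_prod_XsubC //.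
  rewrite size_mul ?expf_neq0 // expr2 size_mul // sD.
  move: b0 Q10; rewrite -!size_poly_gt0; move: sz1 sQ1 sb.
  move: (size b) (size Q1) (size s1) => x y z; clear -dk m0 => ez zy xk x0 y0 ez'.
  have z4 : (z < 4)%N by rewrite -(ltn_pmul2r (ltn0Sn k)); lia.
  by lia.
case: s1 s12 us1 eD eh1 {sz1} => [|v1 [|v2 [|]]] //= _ v12 eD eh1.
rewrite inE andbT in v12; rewrite !big_cons big_nil mulr1 in eD eh1.
(* The affine map [c *: 'X + mu%:P] takes 1 and -1 to [v1] and [v2]. *)
pose c := (v1 - v2) / 2; pose mu := (v1 + v2) / 2.
have c0 : c != 0 by rewrite mulf_neq0 ?invr_eq0 ?pnatr_eq0 // subr_eq0.
have e1 : v1 = mu + c by rewrite /mu /c; field.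
have e2 : v2 = mu - c by rewrite /mu /c; field.
have {}eD : (g - mu%:P) ^+ 2 - c%:P ^+ 2 = D * b ^+ 2.
  rewrite -eD comp_polyM !comp_polyB !comp_polyX !comp_polyC e1 e2 !rmorphD rmorphN /=; ring.
pose l : {poly F} := c *: 'X + mu%:P.
pose A' := c^-1 *: (g - mu%:P).
have cV : c%:P * c^-1%:P = 1 :> {poly F} by rewrite -rmorphM divff.
have lA' : l \Po A' = g.
  by rewrite /l comp_polyD comp_polyZ comp_polyX comp_polyC scalerA divff // scale1r subrK.
have peA : A' ^+ 2 - D * (c^-1 *: b) ^+ 2 = 1.
  rewrite /A' -!mul_polyC.
  transitivity ((c^-1)%:P ^+ 2 * ((g - mu%:P) ^+ 2 - D * b ^+ 2)); first by ring.
  by rewrite -eD opprB addrC subrK -exprMn mulrC cV expr1n.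
(* After the substitution [l] the factor with roots [v1], [v2] is [c ^+ 2] times ['X ^+ 2 - 1], so
   [H \Po l] is a Chebyshev polynomial up to sign, and its degree fixes the exponent. *)
have peH : (H \Po l) ^+ 2 - ('X ^+ 2 - 1) * (c *: (Q1 \Po l)) ^+ 2 = 1.
  have El : (H \Po l) ^+ 2 = (l - v1%:P) * (l - v2%:P) * (Q1 \Po l) ^+ 2 + 1.
    transitivity (h \Po l); first by rewrite hH rmorphXn.
    have {1}-> : h = h - 1 + 1 by rewrite subrK.
    by rewrite eh1 comp_polyD !comp_polyM !comp_polyB !comp_polyX !comp_polyC -?expr2 ?rmorphXn rmorph1.
  by rewrite El /l e1 e2 -!mul_polyC !rmorphD rmorphN /=; ring.
have sl : size l = 2%N.
  by rewrite /l size_polyDl size_scale // size_polyX ?(leq_ltn_trans (size_polyC_leq1 _)).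
have sHl : size (H \Po l) = m.+1 by rewrite (@size_compS _ _ _ m 0) // muln1.
have [m' [s [e [eH eU]]]] := cheb_descent (eq_leq sHl) peH.
have em : m' = m.
  have := congr1 (fun p : {poly F} => size p) eH; rewrite sHl.
  have -> : size ((-1) ^+ s * (cheb F e m').1) = size (cheb F e m').1.
    by case: (s); rewrite ?expr0 ?expr1 ?mul1r // mulN1r size_polyN.
  by rewrite size_cheb => [] [].
exists A', (c^-1 *: b); split.
  by split=> //; rewrite scaler_eq0 invr_eq0 (negPf c0).
exists s, e; rewrite pell_pow_comp // -em /=.
have sgn (p : {poly F}) : (-1) ^+ s * (p \Po A') = ((-1) ^+ s * p) \Po A'.
  by rewrite rmorphM rmorph_sign.
rewrite mulrA !sgn -eH -eU comp_polyZ -!comp_polyA lA' Hg eb.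
congr (_, _); rewrite -!mul_polyC.
transitivity ((c%:P * (c^-1)%:P) * (b * (Q1 \Po g))); last by ring.
by rewrite cV mul1r.
Qed.

(** * Second-order expansions *)

Section ComplexNorm.
Variable R : realType.
Local Notation C := R[i].
Local Notation re := (@complex.Re R).
Local Notation im := (@complex.Im R).
Local Notation nrm := (@ComplexField.Normc.normc R).
Implicit Types (x y z w : C) (r e : R) (f g : C -> C) (p q : {poly C}).

Lemma nrm_sqr z : nrm z ^+ 2 = re z ^+ 2 + im z ^+ 2.
Proof. by case: z => a b /=; rewrite sqr_sqrtr // addr_ge0 // sqr_ge0. Qed.

Lemma nrm_ge0 z : 0 <= nrm z.
Proof. by case: z => a b /=; rewrite sqrtr_ge0. Qed.

Lemma nrm0 : nrm 0 = 0. Proof. exact: ComplexField.Normc.normc0. Qed.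

Lemma nrm1 : nrm 1 = 1. Proof. exact: ComplexField.Normc.normc1. Qed.

Lemma nrm_eq0 z : (nrm z == 0) = (z == 0).
Proof.
by apply/eqP/eqP => [/ComplexField.Normc.eq0_normc //|->]; rewrite nrm0.
Qed.

Lemma nrm_gt0 z : (0 < nrm z) = (z != 0).
Proof. by rewrite lt_def nrm_ge0 andbT nrm_eq0. Qed.

Lemma nrmM x y : nrm (x * y) = nrm x * nrm y.
Proof. exact: ComplexField.Normc.normcM. Qed.

Lemma nrmV x : nrm x^-1 = (nrm x)^-1.
Proof. exact: ComplexField.Normc.normcV. Qed.

Lemma nrmX x n : nrm (x ^+ n) = nrm x ^+ n.
Proof. by elim: n => [|n IH]; rewrite ?nrm1 // !exprS nrmM IH. Qed.

Lemma nrmD x y : nrm (x + y) <= nrm x + nrm y.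
Proof. exact: le_normcD. Qed.

Lemma nrmN x : nrm (- x) = nrm x.
Proof. exact: normcN. Qed.

Lemma nrmB x y : nrm (x - y) = nrm (y - x).
Proof. by rewrite -nrmN opprB. Qed.

Lemma nrm_tri x y z : nrm (x - z) <= nrm (x - y) + nrm (y - z).
Proof. by have := nrmD (x - y) (y - z); rewrite addrA subrK. Qed.

Lemma nrm_subD x y : nrm x - nrm y <= nrm (x + y).
Proof. by have := nrmD (x + y) (- y); rewrite addrK nrmN; lra. Qed.

Lemma nrm_prod (I : Type) (s : seq I) (P : pred I) (F : I -> C) :
  nrm (\prod_(i <- s | P i) F i) = \prod_(i <- s | P i) nrm (F i).
Proof. by rewrite (big_morph nrm nrmM nrm1). Qed.

Lemma nrm_sum (I : Type) (s : seq I) (P : pred I) (F : I -> C) :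
  nrm (\sum_(i <- s | P i) F i) <= \sum_(i <- s | P i) nrm (F i).
Proof.
elim/big_rec2: _ => [|i y1 y2 _ le]; first by rewrite nrm0.
by apply: le_trans (nrmD _ _) _; rewrite lerD2l.
Qed.

Lemma nrm_real r : nrm r%:C%C = `|r|.
Proof. by rewrite /= expr0n addr0 sqrtr_sqr. Qed.

Lemma normr_ltC z e : (`|z| < e%:C%C) = (nrm z < e).
Proof. by rewrite normc_def ltcR; case: z. Qed.

Lemma nrm_ReIm z : nrm z <= `|re z| + `|im z|.
Proof.
rewrite -ler_sqr ?nnegrE ?nrm_ge0 ?addr_ge0 // nrm_sqr.
rewrite -[re z ^+ 2]real_normK ?num_real // -[im z ^+ 2]real_normK ?num_real //.
have := mulr_ge0 (normr_ge0 (re z)) (normr_ge0 (im z)); nra.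
Qed.

Lemma Re_nrm z : `|re z| <= nrm z.
Proof.
rewrite -ler_sqr ?nnegrE ?nrm_ge0 // real_normK ?num_real // nrm_sqr.
by rewrite lerDl sqr_ge0.
Qed.

Lemma Im_nrm z : `|im z| <= nrm z.
Proof.
rewrite -ler_sqr ?nnegrE ?nrm_ge0 // real_normK ?num_real // nrm_sqr.
by rewrite lerDr sqr_ge0.
Qed.

Lemma poly_growth p : exists2 K, 0 <= K &
  forall z, nrm p.[z] <= K * (1 + nrm z) ^+ (size p).-1.
Proof.
exists (\sum_(i < size p) nrm p`_i) => [|z]; first by rewrite sumr_ge0 // => i _; exact: nrm_ge0.
rewrite horner_coef mulr_suml; apply: le_trans (nrm_sum _ _ _) _.
apply: ler_sum => i _; rewrite nrmM nrmX ler_wpM2l ?nrm_ge0 //.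
have le1 : nrm z <= 1 + nrm z by lra.
apply: le_trans (lerXn2r i _ _ le1) _; rewrite ?nnegrE ?addr_ge0 ?nrm_ge0 //.
rewrite ler_weXn2l //; first by rewrite lerDl nrm_ge0.
by case: i => i /=; case: (size p).
Qed.

Definition nearby z0 (Q : C -> Prop) := exists2 d : R, 0 < d & forall z, nrm (z - z0) < d -> Q z.

Lemma nearT z0 (Q : C -> Prop) : (forall z, Q z) -> nearby z0 Q.
Proof. by move=> h; exists 1. Qed.

Lemma near_and z0 (P Q : C -> Prop) : nearby z0 P -> nearby z0 Q -> nearby z0 (fun z => P z /\ Q z).
Proof.
move=> [d d0 hd] [e e0 he]; exists (Num.min d e) => [|z]; first by rewrite lt_min d0.
by rewrite lt_min => /andP[zd ze]; split; [exact: hd|exact: he].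
Qed.

Lemma near_imp z0 (P Q : C -> Prop) : (forall z, P z -> Q z) -> nearby z0 P -> nearby z0 Q.
Proof. by move=> PQ [d d0 hd]; exists d => // z /hd/PQ. Qed.

Lemma near_at z0 (P : C -> Prop) : nearby z0 P -> P z0.
Proof. by case=> d d0; apply; rewrite subrr nrm0. Qed.

Lemma near_neq z0 s : z0 != s -> nearby z0 (fun z => nrm (z0 - s) / 2 <= nrm (z - s)).
Proof.
move=> zs; exists (nrm (z0 - s) / 2); first by rewrite divr_gt0 ?nrm_gt0 ?subr_eq0.
by move=> z; rewrite nrmB; have := nrm_tri z0 z s; lra.
Qed.

Definition bdd_near z0 f := exists M, nearby z0 (fun z => nrm (f z) <= M).

Lemma bdd_poly z0 p : bdd_near z0 (fun z => p.[z]).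
Proof.
have [K K0 hK] := poly_growth p; exists (K * (2 + nrm z0) ^+ (size p).-1).
exists 1 => // z zz; apply: le_trans (hK z) _; rewrite ler_wpM2l //.
have := nrm_ge0 z; have := nrm_ge0 z0; have := nrmD (z - z0) z0; rewrite subrK => *.
by apply: lerXn2r; rewrite ?nnegrE; lra.
Qed.

Lemma bddD z0 f g : bdd_near z0 f -> bdd_near z0 g -> bdd_near z0 (fun z => f z + g z).
Proof.
move=> [M hM] [N hN]; exists (M + N); apply: near_imp (near_and hM hN) => z [a b].
by apply: le_trans (nrmD _ _) _; exact: lerD.
Qed.

Lemma bddM z0 f g : bdd_near z0 f -> bdd_near z0 g -> bdd_near z0 (fun z => f z * g z).
Proof.
move=> [M hM] [N hN]; exists (M * N); apply: near_imp (near_and hM hN) => z [a b].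
by rewrite nrmM ler_pM ?nrm_ge0.
Qed.

(* [f] agrees with a polynomial up to third order at [z0]; everything below
   needs no more regularity than this. *)
Definition jet2 f z0 := exists p g, bdd_near z0 g /\
  nearby z0 (fun z => f z = p.[z] + (z - z0) ^+ 3 * g z).

Lemma jet2_poly p z0 : jet2 (fun z => p.[z]) z0.
Proof.
exists p, (fun=> 0); split; first by exists 0; apply: nearT => z; rewrite nrm0.
by apply: nearT => z; rewrite mulr0 addr0.
Qed.

Lemma eq_jet2 f g z0 : nearby z0 (fun z => f z = g z) -> jet2 f z0 -> jet2 g z0.
Proof.
move=> fg [p [h [bh hf]]]; exists p, h; split=> //.
by apply: near_imp (near_and fg hf) => z [<-].
Qed.

Lemma jet2D f g z0 : jet2 f z0 -> jet2 g z0 -> jet2 (fun z => f z + g z) z0.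
Proof.
move=> [p [h [bh hf]]] [q [k [bk hg]]].
exists (p + q), (fun z => h z + k z); split; first exact: bddD.
apply: near_imp (near_and hf hg) => z [-> ->]; rewrite hornerD; ring.
Qed.

Lemma jet2M f g z0 : jet2 f z0 -> jet2 g z0 -> jet2 (fun z => f z * g z) z0.
Proof.
move=> [p [h [bh hf]]] [q [k [bk hg]]].
exists (p * q), (fun z => p.[z] * k z + h z * q.[z] + (('X - z0%:P) ^+ 3).[z] * (h z * k z)).
split; first by repeat (apply: bddD || apply: bddM) => //; exact: bdd_poly.
apply: near_imp (near_and hf hg) => z [-> ->]; rewrite hornerM horner_exp hornerXsubC; ring.
Qed.

Lemma jet2X f n z0 : jet2 f z0 -> jet2 (fun z => f z ^+ n) z0.
Proof.
move=> jf; elim: n => [|n IH].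
  by apply: eq_jet2 (jet2_poly 1 z0); apply: nearT => z; rewrite hornerC.
by apply: eq_jet2 (jet2M jf IH); apply: nearT => z; rewrite exprS.
Qed.

Lemma jet2_prod (I : Type) (s : seq I) (P : pred I) (F : I -> C -> C) z0 :
  (forall i, jet2 (F i) z0) -> jet2 (fun z => \prod_(i <- s | P i) F i z) z0.
Proof.
move=> jF; elim: s => [|i s IH].
  by apply: eq_jet2 (jet2_poly 1 z0); apply: nearT => z; rewrite big_nil hornerC.
have [Pi|Pi] := boolP (P i).
  by apply: eq_jet2 (jet2M (jF i) IH); apply: nearT => z; rewrite big_cons Pi.
by apply: eq_jet2 IH; apply: nearT => z; rewrite big_cons (negPf Pi).
Qed.

Lemma poly_taylor1 p z0 : exists q, p = p.[z0]%:P + ('X - z0%:P) * q.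
Proof.
have /factor_theorem[q eq] : root (p - p.[z0]%:P) z0 by rewrite /root !hornerE subrr.
by exists q; rewrite mulrC -eq addrC subrK.
Qed.

Lemma poly_taylor3 p z0 : exists a b c q, forall z,
  p.[z] = a + b * (z - z0) + c * (z - z0) ^+ 2 + (z - z0) ^+ 3 * q.[z].
Proof.
have [q1 e1] := poly_taylor1 p z0; have [q2 e2] := poly_taylor1 q1 z0.
have [q3 e3] := poly_taylor1 q2 z0.
exists p.[z0], q1.[z0], q2.[z0], q3 => z.
rewrite {1}e1 {1}e2 {1}e3 !(hornerXsubC, hornerD, hornerM, hornerC); ring.
Qed.

Lemma jet2_expand f z0 : jet2 f z0 -> exists a b c g, bdd_near z0 g /\
  nearby z0 (fun z => f z = a + b * (z - z0) + c * (z - z0) ^+ 2 + (z - z0) ^+ 3 * g z).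
Proof.
move=> [p [g [bg hf]]]; have [a [b [c [q hq]]]] := poly_taylor3 p z0.
exists a, b, c, (fun z => q.[z] + g z); split; first exact: bddD (bdd_poly _ _) bg.
by apply: near_imp hf => z ->; rewrite hq; ring.
Qed.

Lemma jet2_lip f z0 : jet2 f z0 -> exists K, nearby z0 (fun z => nrm (f z - f z0) <= K * nrm (z - z0)).
Proof.
move=> [p [g [bg hf]]]; have [q e] := poly_taylor1 p z0.
have [M hM] : bdd_near z0 (fun z => q.[z] + (('X - z0%:P) ^+ 2).[z] * g z).
  by apply: bddD; [exact: bdd_poly|apply: bddM => //; exact: bdd_poly].
exists M; have f0 := near_at hf.
apply: near_imp (near_and hf hM) => z [-> h]; rewrite f0 subrr expr0n mul0r addr0.
rewrite {1}e hornerD hornerM hornerC hornerXsubC.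
have -> : p.[z0] + (z - z0) * q.[z] + (z - z0) ^+ 3 * g z - p.[z0] =
  (q.[z] + (z - z0) ^+ 2 * g z) * (z - z0) by ring.
by rewrite nrmM ler_wpM2r ?nrm_ge0 //; move: h; rewrite horner_exp hornerXsubC.
Qed.

Lemma jet2_inv s z0 : z0 != s -> jet2 (fun z => (z - s)^-1) z0.
Proof.
move=> zs; pose a := z0 - s; have a0 : a != 0 by rewrite subr_eq0.
(* The geometric series of [1 / (a + w)] in [w = z - z0], cut after [w ^+ 2], with its exact
   remainder. *)
exists ((a^-1)%:P - (a^-1 ^+ 2) *: ('X - z0%:P) + (a^-1 ^+ 3) *: ('X - z0%:P) ^+ 2).
exists (fun z => - (a^-1 ^+ 3 / (z - s))); have [d d0 hd] := near_neq zs; split.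
  exists (nrm (a^-1) ^+ 3 * (nrm a / 2)^-1); exists d => // z /hd h.
  rewrite nrmN nrmM nrmX; apply: ler_wpM2l; rewrite ?exprn_ge0 ?nrm_ge0 // nrmV.
  by rewrite lef_pV2 // posrE ?(lt_le_trans _ h) // divr_gt0 ?nrm_gt0.
exists d => // z /hd h; rewrite !(hornerXsubC, hornerD, hornerN, hornerX, hornerZ, hornerC, horner_exp).
have zs0 : z - s != 0 by rewrite -nrm_gt0 (lt_le_trans _ h) // divr_gt0 ?nrm_gt0.
have -> : z0 = a + s by rewrite subrK.
clearbody a.
by field; rewrite a0 zs0.
Qed.

End ComplexNorm.

(** * Maximum principle and Liouville's theorem *)

Section MaximumPrinciple.
Import numFieldNormedType.Exports.

Lemma square_max (R : realType) (f : R -> R -> R) (r : R) : 0 <= r ->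
  (forall x y e, 0 < e -> exists2 d, 0 < d &
    forall x' y', `|x' - x| < d -> `|y' - y| < d -> `|f x' y' - f x y| < e) ->
  exists x y, [/\ `|x| <= r, `|y| <= r &
    forall x' y', `|x'| <= r -> `|y'| <= r -> f x' y' <= f x y].
Proof.
move=> r0 fc.
have inI x : (`|x| <= r) = (x \in `[- r, r]) by rewrite in_itv /= ler_norml.
have cf : continuous (fun u : R * R => f u.1 u.2).
  move=> [x y]; apply/cvgrPdist_lt => e e0; have [d d0 hd] := fc x y e e0.
  near=> u; rewrite distrC; apply: hd.
    near: u; exists (ball x d, setT); first by split; [exact: nbhsx_ballx|exact: filterT].
    by move=> [a b] [/= h _]; rewrite distrC.
  near: u; exists (setT, ball y d); first by split; [exact: filterT|exact: nbhsx_ballx].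
  by move=> [a b] [_ /= h]; rewrite distrC.
have I0 : (`[- r, r] `*` `[- r, r] !=set0)%classic.
  by exists (0, 0); split => /=; rewrite -inI normr0.
have cI := compact_setX (segment_compact (a := - r) (b := r)) (segment_compact (a := - r) (b := r)).
have [[x y] xy hm] := compact_EVT_max I0 cI (continuous_subspaceT cf).
move: xy; rewrite inE => -[/= xr yr].
exists x, y; rewrite !inI; split=> // x' y' hx hy.
by apply: (hm (x', y')); rewrite inE; split => /=; rewrite -inI.
Unshelve. all: by end_near. Qed.

Variable R : realType.
Local Notation C := R[i].
Local Notation re := (@complex.Re R).
Local Notation im := (@complex.Im R).
Local Notation nrm := (@ComplexField.Normc.normc R).

(* Averaging over the four points [z0 + i^j r] kills the mixed second-order terms. *)
Lemma four_point_sum (a b c z0 : C) (r e : R) :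
  let psi (w : C) := nrm (a + b * w + c * w ^+ 2) ^+ 2 + e * nrm (z0 + w) ^+ 2 in
  psi (Complex r 0) + psi (Complex (- r) 0) + psi (Complex 0 r) + psi (Complex 0 (- r)) =
  4 * (nrm a ^+ 2 + e * nrm z0 ^+ 2 + e * r ^+ 2) + 4 * nrm b ^+ 2 * r ^+ 2 + 4 * nrm c ^+ 2 * r ^+ 4.
Proof.
case: a b c z0 => [a1 a2] [b1 b2] [c1 c2] [z1 z2] psi.
rewrite /psi !nrm_sqr !expr2; simpc => /=; ring.
Qed.

Lemma nrm_sqr_perturb (x y : C) : nrm x ^+ 2 - 2 * nrm x * nrm y <= nrm (x + y) ^+ 2.
Proof.
have := nrm_subD x y; have := nrm_ge0 x; have := nrm_ge0 y; have := nrm_ge0 (x + y).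
move: (nrm (x + y)) (nrm x) (nrm y) => s t u s0 u0 t0 stu.
by have [tu|ut] := leP u t; nra.
Qed.

(** Over the four points the quadratic part of [f] already sums to at least four times the central
    value plus [4 * e * r ^+ 2], while the cubic remainder costs only a multiple of [r ^+ 3]; this
    is where [e > 0] is needed. *)
Lemma jet2_no_max (f : C -> C) (z0 : C) (e : R) : jet2 f z0 -> 0 < e ->
  ~ nearby z0 (fun z => nrm (f z) ^+ 2 + e * nrm z ^+ 2 <= nrm (f z0) ^+ 2 + e * nrm z0 ^+ 2).
Proof.
move=> /jet2_expand[a [b [c [g [[M hM] hf]]]]] e0 hmax.
have fz0 : f z0 = a.
  by rewrite (near_at hf) subrr !expr0n !mulr0 mul0r !addr0.
have M0 : 0 <= M := le_trans (nrm_ge0 _) (near_at hM).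
have [d d0 hd] := near_and (near_and hM hf) hmax.
pose A := nrm a + nrm b + nrm c.
have A0 : 0 <= A by rewrite !addr_ge0 ?nrm_ge0.
(* The first bound stays in the disc and, by [r <= 1], gives [nrm G <= A]; the second makes the
   cubic loss [2 * A * M * r ^+ 3] smaller than [e * r ^+ 2]. *)
pose r := Num.min (Num.min d 1 / 2) (e / (4 * (A * M + 1))).
have AM : 0 <= A * M by rewrite mulr_ge0.
have AM1 : 0 < 4 * (A * M + 1) by lra.
have r0 : 0 < r by rewrite lt_min !divr_gt0 // lt_min d0 ltr01.
have rd : r <= Num.min d 1 / 2 by rewrite ge_min lexx.
have [md m1] : Num.min d 1 <= d /\ Num.min d 1 <= 1 by rewrite !ge_min !lexx orbT.
have re : r * (4 * (A * M + 1)) <= e.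
  by rewrite -ler_pdivlMr ?ge_min ?lexx ?orbT //; lra.
have key w : nrm w = r ->
    nrm (a + b * w + c * w ^+ 2) ^+ 2 + e * nrm (z0 + w) ^+ 2 <=
    nrm a ^+ 2 + e * nrm z0 ^+ 2 + 2 * A * M * r ^+ 3.
  move=> wr; have zw : z0 + w - z0 = w by rewrite addrC addKr.
  have [|[hg hfz] hmx] := hd (z0 + w); first by rewrite zw wr; lra.
  move: hmx; rewrite fz0 hfz zw; set G := a + b * w + _.
  have GA : nrm G <= A.
    apply: le_trans (nrmD _ _) _; apply: lerD; last first.
      by rewrite nrmM nrmX wr ler_piMr ?nrm_ge0 //; nra.
    apply: le_trans (nrmD _ _) _; rewrite lerD2l nrmM wr ler_piMr ?nrm_ge0 //; lra.
  have := nrm_sqr_perturb G (w ^+ 3 * g (z0 + w)).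
  have : nrm G * nrm (w ^+ 3 * g (z0 + w)) <= A * (r ^+ 3 * M).
    rewrite nrmM nrmX wr; apply: ler_pM => //; first exact: nrm_ge0.
      by rewrite mulr_ge0 ?nrm_ge0 // exprn_ge0 // ltW.
    by rewrite ler_pM2l // exprn_gt0.
  by lra.
have nr : forall s, `|s| = r -> nrm (Complex s 0) = r /\ nrm (Complex 0 s) = r.
  by move=> s sr; rewrite /= expr0n addr0 add0r sqrtr_sqr sr.
have [k1 k3] := nr r (ger0_norm (ltW r0)).
have [k2 k4] := nr (- r) (eq_trans (normrN _) (ger0_norm (ltW r0))).
have := four_point_sum a b c z0 r e => /=.
have := key _ k1; have := key _ k2; have := key _ k3; have := key _ k4.
rewrite /=.
have hb : 0 <= 4 * nrm b ^+ 2 * r ^+ 2 by rewrite !mulr_ge0 ?exprn_ge0 ?nrm_ge0 // ltW.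
have hc : 0 <= 4 * nrm c ^+ 2 * r ^+ 4 by rewrite !mulr_ge0 ?exprn_ge0 ?nrm_ge0 // ltW.
have r2 : 0 < r ^+ 2 by rewrite exprn_gt0.
have : 2 * A * M * r ^+ 3 < e * r ^+ 2.
  have -> : 2 * A * M * r ^+ 3 = (r * (2 * (A * M))) * r ^+ 2 by ring.
  by rewrite ltr_pM2r //; nra.
by lra.
Qed.

Definition lip_at (f : C -> C) (z0 : C) :=
  exists K, nearby z0 (fun z => nrm (f z - f z0) <= K * nrm (z - z0)).

Lemma lip_at_sqr (f : C -> C) (z0 : C) : lip_at f z0 ->
  exists2 K, 0 <= K & nearby z0 (fun z => `|nrm (f z) ^+ 2 - nrm (f z0) ^+ 2| <= K * nrm (z - z0)).
Proof.
move=> [K hK]; pose L := `|K|; have L0 : 0 <= L := normr_ge0 K.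
have n0 := nrm_ge0 (f z0).
exists (L * (2 * nrm (f z0) + L)); first by apply: mulr_ge0 => //; lra.
have [d d0 hd] := hK; exists (Num.min d 1) => [|z]; first by rewrite lt_min d0 /=.
rewrite lt_min => /andP[/hd h z1].
have {h} h : nrm (f z - f z0) <= L * nrm (z - z0).
  by apply: le_trans h _; rewrite ler_wpM2r ?nrm_ge0 // ler_norm.
have hL : L * nrm (z - z0) <= L by rewrite ler_piMr // ltW.
have d1 : `|nrm (f z) - nrm (f z0)| <= L * nrm (z - z0).
  have := nrm_tri (f z) (f z0) 0; have := nrm_tri (f z0) (f z) 0.
  by rewrite !subr0 nrmB ler_norml => h1 h2; apply/andP; split; lra.
rewrite subr_sqr normrM [in leRHS]mulrAC; apply: ler_pM => //.
rewrite ger0_norm ?addr_ge0 ?nrm_ge0 //; move: d1; rewrite ler_norml => /andP[]; lra.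
Qed.

(** At a point of [s] no expansion is assumed, but the product vanishes there, hence so does [f],
    and a polynomial bound with a zero is a Lipschitz bound. *)
Lemma lip_at_vanishing (f : C -> C) (s : seq C) (K : R) :
  (forall z, z \notin s -> jet2 f z) ->
  (forall z, nrm (f z) <= K * nrm (\prod_(v <- s) (z - v))) -> forall z, lip_at f z.
Proof.
move=> jf fK z; have [zs|/jf] := boolP (z \in s); last exact: jet2_lip.
have Q0 : \prod_(v <- s) (z - v) = 0 by rewrite (big_rem z zs) /= subrr mul0r.
have f0 : f z = 0.
  by apply/eqP; rewrite -nrm_eq0 eq_le nrm_ge0 andbT; have := fK z; rewrite Q0 nrm0 mulr0.
have [L hL] := jet2_lip (jet2_poly (\prod_(v <- s) ('X - v%:P)) z).
exists (`|K| * L); apply: near_imp hL => w; rewrite !horner_prod.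
under eq_bigr do rewrite hornerXsubC; under [X in _ - X]eq_bigr do rewrite hornerXsubC.
rewrite Q0 f0 !subr0 => h; apply: le_trans (fK w) _.
rewrite -mulrA; apply: le_trans (_ : `|K| * nrm (\prod_(v <- s) (w - v)) <= _).
  by rewrite ler_wpM2r ?nrm_ge0 // ler_norm.
by rewrite ler_wpM2l.
Qed.

Lemma vanishing_at_infinity (f : C -> C) (s : seq C) (K : R) :
  (forall z, z \notin s -> jet2 f z) ->
  (forall z, nrm (f z) <= K * nrm (\prod_(v <- s) (z - v))) ->
  (forall z, nrm (f z) * (1 + nrm z) <= K) -> forall z, f z = 0.
Proof.
move=> jf fK fK1 z0; apply/eqP; rewrite -nrm_eq0; apply/negPn/negP => t0.
have {t0} t0 : 0 < nrm (f z0) by rewrite lt_def t0 nrm_ge0.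
have K0 : 0 <= K by apply: le_trans _ (fK1 z0); rewrite mulr_ge0 ?addr_ge0 ?nrm_ge0.
(* [r] exceeds [nrm z0], so the square of half-side [r] contains [z0]; the term [2 * K / t] brings
   [nrm (f z)] below [t / 2] once [nrm z >= r]. *)
set t := nrm (f z0) in t0; pose r := 1 + nrm z0 + 2 * K / t.
have Kt : 0 <= 2 * K / t by rewrite mulr_ge0 ?invr_ge0 ?(ltW t0) // mulr_ge0.
have r1 : 1 + nrm z0 <= r by rewrite lerDl.
have r0 : 0 < r by have := nrm_ge0 z0; lra.
(* On the square [nrm z ^+ 2 <= 2 * r ^+ 2], so the perturbation is at most [t ^+ 2 / 4]. On the
   sides of the square and on [s] the function [psi] is then at most [t ^+ 2 / 2], below its value
   at [z0]: its maximum is interior and off [s]. *)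
pose e := t ^+ 2 / (8 * r ^+ 2).
have r2 : 0 < 8 * r ^+ 2 by rewrite mulr_gt0 // exprn_gt0.
have e0 : 0 < e by rewrite divr_gt0 // exprn_gt0.
have er : e * (8 * r ^+ 2) = t ^+ 2 by rewrite divfK // gt_eqF.
have far z : r <= nrm z -> nrm (f z) ^+ 2 <= t ^+ 2 / 4.
  move=> rz; have h : nrm (f z) * (2 * K / t) <= K.
    apply: le_trans _ (fK1 z); rewrite ler_wpM2l ?nrm_ge0 //.
    by move: rz (nrm_ge0 z0); rewrite /r; lra.
  have {h} h : nrm (f z) <= t / 2.
    have [K00|Kn0] := eqVneq K 0.
      have := fK1 z; rewrite K00 pmulr_lle0; last by have := nrm_ge0 z; lra.
      lra.
    rewrite -(ler_pM2r (_ : 0 < 2 * K / t)); last by rewrite divr_gt0 // mulr_gt0 // lt_def Kn0.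
    by apply: le_trans h _; rewrite le_eqVlt; apply/orP; left; apply/eqP; field; rewrite gt_eqF.
  by have := nrm_ge0 (f z); nra.
pose psi x y := nrm (f (Complex x y)) ^+ 2 + e * nrm (Complex x y) ^+ 2.
have cpsi x y e' : 0 < e' -> exists2 d, 0 < d &
    forall x' y', `|x' - x| < d -> `|y' - y| < d -> `|psi x' y' - psi x y| < e'.
  move=> e'0; have [L1 L10 [d1 d10 h1]] := lip_at_sqr (lip_at_vanishing jf fK (Complex x y)).
  have [|L2 L20 [d2 d20 h2]] := @lip_at_sqr id (Complex x y).
    by exists 1, 1 => // z _; rewrite mul1r.
  pose L := 2 * (L1 + e * L2) + 1; have eL2 : 0 <= e * L2 by rewrite mulr_ge0 // ltW.
  have L0 : 0 < L by rewrite /L; lra.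
  exists (Num.min (Num.min d1 d2 / 2) (e' / L)).
    by rewrite lt_min !divr_gt0 // lt_min d10.
  move=> x' y'; rewrite !lt_min => /andP[xd xe] /andP[yd ye].
  have [m1 m2] : Num.min d1 d2 <= d1 /\ Num.min d1 d2 <= d2 by rewrite !ge_min !lexx orbT.
  set w := Complex x' y'; set w0 := Complex x y.
  have nw : nrm (w - w0) <= `|x' - x| + `|y' - y| by have := nrm_ReIm (w - w0).
  have /h1 hf : nrm (w - w0) < d1 by lra.
  have /h2 hi : nrm (w - w0) < d2 by lra.
  have : psi x' y' - psi x y = (nrm (f w) ^+ 2 - nrm (f w0) ^+ 2) +
     e * (nrm w ^+ 2 - nrm w0 ^+ 2) by rewrite /psi; ring.
  move=> ->; apply: le_lt_trans (ler_normD _ _) _; rewrite normrM (gtr0_norm e0).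
  apply: le_lt_trans (_ : (L1 + e * L2) * nrm (w - w0) < _).
    rewrite mulrDl; apply: lerD => //; rewrite -[e * L2 * _]mulrA.
    by apply: ler_wpM2l => //; exact: ltW.
  have : nrm (w - w0) < 2 * (e' / L) by lra.
  have : (2 * (L1 + e * L2) + 1) * (e' / L) = e' by rewrite -/L mulrC divfK // gt_eqF.
  have : 0 < e' / L by rewrite divr_gt0.
  have := nrm_ge0 (w - w0); move: (nrm _) (e' / L) => n q; nra.
have [x [y [xr yr hmax]]] := square_max (ltW r0) cpsi.
set z1 := Complex x y.
have big : t ^+ 2 <= psi x y.
  have z0r : nrm z0 <= r by lra.
  have := hmax (re z0) (im z0) (le_trans (Re_nrm _) z0r) (le_trans (Im_nrm _) z0r).
  apply: le_trans; rewrite /psi; have -> : Complex (re z0) (im z0) = z0 by case: (z0).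
  by rewrite lerDl mulr_ge0 ?exprn_ge0 ?nrm_ge0 // ltW.
have ez1 : e * nrm z1 ^+ 2 <= t ^+ 2 / 4.
  have : nrm z1 ^+ 2 <= 2 * r ^+ 2.
    rewrite nrm_sqr /= -[x ^+ 2]real_normK ?num_real // -[y ^+ 2]real_normK ?num_real //.
    by have := normr_ge0 x; have := normr_ge0 y; nra.
  by move: er e0; move: (nrm z1 ^+ 2) (r ^+ 2) => a b; nra.
have t2 : 0 < t ^+ 2 by rewrite exprn_gt0.
have small : ~ nrm (f z1) ^+ 2 <= t ^+ 2 / 4 by move=> h; move: big; rewrite /psi -/z1; lra.
have xlt : `|x| < r.
  by rewrite lt_def xr andbT; apply/negP => /eqP rx; apply/small/far; rewrite rx; exact: (Re_nrm z1).
have ylt : `|y| < r.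
  by rewrite lt_def yr andbT; apply/negP => /eqP rx; apply/small/far; rewrite rx; exact: (Im_nrm z1).
have z1s : z1 \notin s.
  apply/negP => z1s; apply: small; have := fK z1.
  rewrite (big_rem z1 z1s) /= subrr mul0r nrm0 mulr0 => h.
  by have := nrm_ge0 (f z1); nra.
apply: (jet2_no_max (jf _ z1s) e0); exists (Num.min (r - `|x|) (r - `|y|)).
  by rewrite lt_min !subr_gt0 xlt.
move=> [a b]; rewrite lt_min => /andP[h1 h2]; apply: hmax.
  have := Re_nrm (Complex a b - z1); have := ler_normD x (a - x).
  have -> : x + (a - x) = a by ring.
  by move: h1 => /=; lra.
have := Im_nrm (Complex a b - z1); have := ler_normD y (b - y).
have -> : y + (b - y) = b by ring.
by move: h2 => /=; lra.
Qed.

End MaximumPrinciple.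

(** * Polynomial growth with finitely many exceptional points *)

Section Liouville.
Variable R : realType.
Local Notation C := R[i].
Local Notation re := (@complex.Re R).
Local Notation im := (@complex.Im R).
Local Notation nrm := (@ComplexField.Normc.normc R).

Lemma exists_notin (s : seq C) : exists z, z \notin s.
Proof.
have s0 (t : seq C) : 0 <= \sum_(v <- t) nrm v by rewrite sumr_ge0 // => v _; exact: nrm_ge0.
set M := \sum_(v <- s) nrm v; pose z := Complex (1 + M) 0; exists z; apply/negP => zs.
have nz : nrm z = 1 + M by rewrite /= expr0n addr0 sqrtr_sqr ger0_norm // addr_ge0 ?s0.
by have := s0 (rem z s); have := erefl M; rewrite {1}/M (big_rem z zs) nz /=; lra.
Qed.

Lemma jet2_divdiff (f : C -> C) (z1 z0 : C) : z0 != z1 -> jet2 f z0 ->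
  jet2 (fun z => (f z - f z1) / (z - z1)) z0.
Proof.
move=> z01 jf; apply: jet2M; last exact: jet2_inv.
have := jet2D jf (jet2_poly (- (f z1))%:P z0).
by apply: eq_jet2; exists 1 => // z _; rewrite hornerC.
Qed.

Lemma divdiff_growth (f : C -> C) (z1 : C) (s : seq C) (K : R) (k : nat) :
  jet2 f z1 -> (forall z, z \notin s -> nrm (f z) <= K * (1 + nrm z) ^+ k) ->
  exists2 K', 0 <= K' & forall z, z \notin z1 :: s ->
    nrm ((f z - f z1) / (z - z1)) * (1 + nrm z) <= K' * (1 + nrm z) ^+ k.
Proof.
move=> jf hK; have [L [d d0 hd]] := jet2_lip jf.
have n1 := nrm_ge0 z1; have nf := nrm_ge0 (f z1).
have L0 : 0 <= `|L| := normr_ge0 L; have K0 := normr_ge0 K.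
(* At distance at least [d] from [z1] one has [1 + nrm z <= c * nrm (z - z1)]; closer in, the
   Lipschitz constant bounds the quotient, which gives [K1]. *)
pose c := 1 + (1 + nrm z1) / d; have c0 : 0 <= (1 + nrm z1) / d by rewrite divr_ge0 ?ltW //; lra.
pose K1 := `|L| * (1 + nrm z1 + d); pose K2 := (`|K| + nrm (f z1)) * c.
have K10 : 0 <= K1 by apply: mulr_ge0 => //; lra.
have K20 : 0 <= K2 by apply: mulr_ge0; rewrite /c; lra.
exists (K1 + K2) => [|z]; first exact: addr_ge0.
rewrite inE negb_or => /andP[zz1 zs].
have zn : 0 < nrm (z - z1) by rewrite nrm_gt0 subr_eq0.
have nz := nrm_ge0 z.
have e1 : 1 <= (1 + nrm z) ^+ k by rewrite exprn_ege1 //; lra.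
have tri : nrm z <= nrm (z - z1) + nrm z1 by have := nrmD (z - z1) z1; rewrite subrK.
rewrite nrmM nrmV; have [near1|far1] := ltP (nrm (z - z1)) d.
  have h : nrm (f z - f z1) / nrm (z - z1) <= `|L|.
    rewrite ler_pdivrMr //; apply: le_trans (hd _ near1) _.
    by rewrite ler_wpM2r ?ler_norm // ltW.
  apply: (@le_trans _ _ (K1 * 1)); last by apply: ler_pM => //; lra.
  rewrite mulr1; apply: ler_pM => //; [|lra|lra].
  by apply: divr_ge0; rewrite ?nrm_ge0.
have h : nrm (f z - f z1) <= (`|K| + nrm (f z1)) * (1 + nrm z) ^+ k.
  apply: le_trans (nrmD _ _) _; rewrite nrmN mulrDl; apply: lerD.
    by apply: le_trans (hK _ zs) _; rewrite ler_wpM2r ?ler_norm //; lra.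
  by rewrite ler_peMr.
have h2 : (1 + nrm z) / nrm (z - z1) <= c.
  rewrite ler_pdivrMr // /c mulrDl mul1r.
  have : (1 + nrm z1) / d * d <= (1 + nrm z1) / d * nrm (z - z1) by rewrite ler_wpM2l.
  by rewrite divfK ?gt_eqF //; lra.
apply: (@le_trans _ _ (K2 * (1 + nrm z) ^+ k)); last by rewrite ler_wpM2r ?lerDr //; lra.
rewrite mulrAC -mulrA /K2 [leRHS]mulrAC; apply: ler_pM => //; first exact: nrm_ge0.
by apply: divr_ge0; lra.
Qed.

Lemma bounded_vanishing (f : C -> C) (s : seq C) (K : R) :
  (forall z, z \notin s -> jet2 f z) ->
  (forall z, z \notin s -> nrm (f z) * (1 + nrm z) <= K) -> forall z, z \notin s -> f z = 0.
Proof.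
move=> jf fK z zs.
have K0 : 0 <= K by apply: le_trans _ (fK z zs); rewrite mulr_ge0 ?addr_ge0 ?nrm_ge0.
pose Q : {poly C} := \prod_(v <- s) ('X - v%:P).
have QE w : Q.[w] = \prod_(v <- s) (w - v).
  by rewrite horner_prod; under eq_bigr do rewrite hornerXsubC.
have Qs w : (Q.[w] == 0) = (w \in s) by rewrite -/(root Q w) root_prod_XsubC.
have [KQ KQ0 hQ] := poly_growth Q; rewrite size_prod_XsubC /= in hQ.
(* [f w ^+ N] decays one order faster than [Q] grows. On [s] the factor [Q] makes [F] vanish,
   whatever value [f] takes there. *)
pose N := (size s).+1; pose F w := f w ^+ N * Q.[w].
have fKw w : w \notin s -> nrm (f w) <= K.
  move=> ws; apply: le_trans _ (fK w ws); rewrite ler_peMr ?nrm_ge0 // lerDl; exact: nrm_ge0.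
have KN0 : 0 <= K ^+ N by rewrite exprn_ge0.
suff F0 : F z = 0.
  by move/eqP: F0; rewrite /F mulf_eq0 Qs (negPf zs) orbF expf_eq0 => /andP[_ /eqP].
apply: (@vanishing_at_infinity R F s (K ^+ N * (1 + KQ))) => w.
- by move=> ws; apply: jet2M; [exact/jet2X/jf|exact: jet2_poly].
- rewrite /F nrmM nrmX QE; have [ws|ws] := boolP (w \in s).
    by rewrite -QE; have := Qs w; rewrite ws => /eqP ->; rewrite nrm0 !mulr0.
  apply: ler_wpM2r; first exact: nrm_ge0.
  apply: (@le_trans _ _ (K ^+ N)); last by rewrite ler_peMr //; lra.
  by apply: lerXn2r; rewrite ?nnegrE ?nrm_ge0 // fKw.
rewrite /F nrmM nrmX; have [ws|ws] := boolP (w \in s).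
  by have := Qs w; rewrite ws => /eqP ->; rewrite nrm0 mulr0 mul0r mulr_ge0 //; lra.
have nw := nrm_ge0 w.
have le1 : nrm (f w) ^+ N * (1 + nrm w) ^+ N <= K ^+ N.
  by rewrite -exprMn; apply: lerXn2r; rewrite ?nnegrE ?fK // mulr_ge0 ?nrm_ge0 //; lra.
apply: (@le_trans _ _ (nrm (f w) ^+ N * (KQ * (1 + nrm w) ^+ size s) * (1 + nrm w))).
  rewrite ler_wpM2r //; first lra.
  by rewrite ler_wpM2l ?exprn_ge0 ?nrm_ge0.
have -> : nrm (f w) ^+ N * (KQ * (1 + nrm w) ^+ size s) * (1 + nrm w) =
  (nrm (f w) ^+ N * (1 + nrm w) ^+ N) * KQ by rewrite [X in _ = _ * X * _]exprS; ring.
by apply: ler_pM => //; [rewrite mulr_ge0 ?exprn_ge0 ?nrm_ge0 //; lra|lra].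
Qed.

(** A divided difference lowers the growth by one but also loses an order of expansion at its base
    point [z1]. So [z1] joins the exceptional points, and the induction must range over all [s]. *)
Lemma liouville (k : nat) (f : C -> C) (s : seq C) (K : R) :
  (forall z, z \notin s -> jet2 f z) ->
  (forall z, z \notin s -> nrm (f z) <= K * (1 + nrm z) ^+ k) ->
  exists2 p : {poly C}, (size p <= k.+1)%N & forall z, z \notin s -> f z = p.[z].
Proof.
elim: k f s K => [|k IH] f s K jf fK; have [z1 z1s] := exists_notin s;
  pose g z := (f z - f z1) / (z - z1);
  have [K' K'0] := divdiff_growth (jf _ z1s) fK; move=> gK.
  have jg z : z \notin z1 :: s -> jet2 g z.
    by rewrite inE negb_or => /andP[zz1 zs]; apply/jet2_divdiff/jf.
  have g0 : forall z, z \notin z1 :: s -> g z = 0.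
    by apply: (bounded_vanishing (K := K') jg) => z /gK; rewrite expr0 mulr1.
  exists (f z1)%:P => [|z zs]; first exact: size_polyC_leq1.
  rewrite hornerC; have [->//|zz1] := eqVneq z z1.
  have := g0 z; rewrite inE negb_or zz1 => /(_ zs)/eqP.
  by rewrite /g mulf_eq0 invr_eq0 !subr_eq0 (negPf zz1) orbF => /eqP.
have jg z : z \notin z1 :: s -> jet2 g z.
  by rewrite inE negb_or => /andP[zz1 zs]; apply/jet2_divdiff/jf.
have [|p sp hp] := IH g (z1 :: s) K' jg.
  move=> z /gK; have h : 0 < 1 + nrm z by have := nrm_ge0 z; lra.
  by rewrite exprSr mulrA ler_pM2r.
exists ((f z1)%:P + ('X - z1%:P) * p) => [|z zs].
  apply: leq_trans (size_polyD _ _) _; rewrite geq_max.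
  rewrite (leq_trans (size_polyC_leq1 _)) //=.
  by apply: leq_trans (size_polyMleq _ _) _; rewrite size_XsubC add2n.
rewrite hornerD hornerC hornerM hornerXsubC; have [->|zz1] := eqVneq z z1.
  by rewrite subrr mul0r addr0.
by rewrite -hp ?inE ?negb_or ?zz1 // /g mulrC divfK ?subr_eq0 // addrC subrK.
Qed.

End Liouville.

(** * Path lifting *)

(** Connectedness of the unit interval, by the supremum of the initial segments on which [A] holds.
    It serves both uniqueness of lifts and reachability of fibres. *)
Lemma locally_const01 (R : realType) (A : R -> Prop) :
  (forall t, 0 <= t <= 1 -> exists2 d : R, 0 < d &
     forall s, 0 <= s <= 1 -> `|s - t| < d -> (A s <-> A t)) ->
  A 0 -> A 1.
Proof.
move=> lc A0; pose S : set R := [set t | 0 <= t <= 1 /\ forall s, 0 <= s <= t -> A s]%classic.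
have S0 : S 0.
  by split; rewrite ?lexx ?ler01 // => s s0; have -> : s = 0 by apply: le_anti; rewrite andbC.
have hS : has_sup S by split; [exists 0|exists 1 => t [/andP[]]].
pose u := sup S.
have u0 : 0 <= u by apply: sup_upper_bound.
have u1 : u <= 1 by apply: ge_sup => [|t [/andP[]]//]; exists 0.
have u01 : 0 <= u <= 1 by rewrite u0.
have [d d0 hd] := lc u u01.
have [t [t01 tA] ut] := sup_adherent d0 hS; rewrite -/u in ut.
have tu : t <= u by apply: sup_upper_bound.
have Au : A u.
  apply/(hd t t01); last by apply: tA; rewrite lexx andbT; case/andP: t01.
  by rewrite ltr_norml; apply/andP; split; lra.
pose v := Num.min 1 (u + d / 2).
have [v1 vd] : v <= 1 /\ v <= u + d / 2 by rewrite !ge_min !lexx orbT.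
have Sv : S v.
  split; first by rewrite v1 le_min ler01 addr_ge0 // divr_ge0 // ltW.
  move=> s /andP[s0 sv]; have [st|ts] := leP s t; first by apply: tA; rewrite s0.
  apply/(hd s) => //; first by apply/andP; split; lra.
  by rewrite ltr_norml; apply/andP; split; lra.
have vu : v <= u by apply: sup_upper_bound.
have -> : 1 = u; last exact: Au.
apply: le_anti; rewrite u1 andbT; move: vu; rewrite /v ge_min => /orP[//|]; lra.
Qed.

Section Paths.
Variable R : realType.
Local Notation C := R[i].
Local Notation nrm := (@ComplexField.Normc.normc R).
Implicit Types (p : {poly C}) (f g : R -> C) (r s t d e : R) (x y z w : C).

Lemma poly_lip p (y : C) : exists2 K, 0 <= K &
  forall x x', nrm (x - y) <= 1 -> nrm (x' - y) <= 1 -> nrm (p.[x] - p.[x']) <= K * nrm (x - x').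
Proof.
elim/poly_ind: p => [|p c [K K0 hK]].
  by exists 0 => // x x' _ _; rewrite !horner0 subrr nrm0 mul0r.
have [M M0 hM] := poly_growth p; pose m := M * (2 + nrm y) ^+ (size p).-1.
have ny := nrm_ge0 y.
have m0 : 0 <= m by rewrite mulr_ge0 // exprn_ge0 //; lra.
have xy x : nrm (x - y) <= 1 -> nrm x <= 1 + nrm y.
  by move=> h; have := nrmD (x - y) y; rewrite subrK; lra.
exists (K * (1 + nrm y) + m) => [|x x' hx hx']; first by rewrite addr_ge0 // mulr_ge0 //; lra.
rewrite !hornerMXaddC.
have -> : p.[x] * x + c - (p.[x'] * x' + c) = (p.[x] - p.[x']) * x + p.[x'] * (x - x') by ring.
apply: le_trans (nrmD _ _) _; rewrite !nrmM mulrDl; apply: lerD.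
  by rewrite [leRHS]mulrAC; apply: ler_pM; rewrite ?nrm_ge0 ?hK ?xy.
apply: ler_wpM2r; first exact: nrm_ge0.
apply: le_trans (hM _) _; apply: ler_wpM2l => //.
have := xy _ hx'; have := nrm_ge0 x' => *; apply: lerXn2r; rewrite ?nnegrE; lra.
Qed.

(** A quantitative local injectivity: near a noncritical point the linear term of [p] dominates the
    difference of the higher-order terms. *)
Lemma poly_bilip p (y : C) : p^`().[y] != 0 -> exists2 r, 0 < r &
  forall x x', nrm (x - y) < r -> nrm (x' - y) < r ->
    nrm (p^`().[y]) / 2 * nrm (x - x') <= nrm (p.[x] - p.[x']).
Proof.
move=> a0; have [q1 e1] := poly_taylor1 p y; have [q e2] := poly_taylor1 q1 y.
have da : p^`().[y] = q1.[y].
  rewrite {1}e1 derivD derivC add0r derivM derivXsubC mul1r hornerD hornerM hornerXsubC subrr.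
  by rewrite mul0r addr0.
rewrite da in a0 *; set a := q1.[y] in a0 *.
have pE x : p.[x] = p.[y] + (x - y) * a + (x - y) ^+ 2 * q.[x].
  by rewrite {1}e1 {1}e2 !(hornerXsubC, hornerD, hornerM, hornerC) -/a; ring.
have [K K0 hK] := poly_lip q y; have [M [d d0 hM]] := bdd_poly y q.
have M0 : 0 <= M by apply: le_trans (nrm_ge0 q.[y]) _; apply: hM; rewrite subrr nrm0.
have na : 0 < nrm a by rewrite nrm_gt0.
(* The nonlinear part [E] below is at most [r * (2 * M + K) * nrm (x - x')]; the last bound on [r]
   makes this at most half the linear term. *)
pose r := Num.min (Num.min d 1) (nrm a / 2 / (2 * M + K + 1)).
have MK : 0 < 2 * M + K + 1 by lra.
have r0 : 0 < r by rewrite !lt_min d0 ltr01 !divr_gt0.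
have [[rd r1] ra] : (r <= d /\ r <= 1) /\ r <= nrm a / 2 / (2 * M + K + 1).
  by rewrite !ge_min !lexx !orbT.
have {}ra : r * (2 * M + K + 1) <= nrm a / 2 by rewrite -ler_pdivlMr.
exists r => // x x' hx hx'.
have -> : p.[x] - p.[x'] = a * (x - x') +
   ((x - x') * ((x - y) + (x' - y)) * q.[x] + (x' - y) ^+ 2 * (q.[x] - q.[x'])).
  by rewrite (pE x) (pE x'); ring.
apply: le_trans _ (nrm_subD _ _); rewrite nrmM.
set E := _ + _ * (q.[x] - _).
suff : nrm E <= nrm a / 2 * nrm (x - x') by lra.
apply: (@le_trans _ _ (r * (2 * M + K) * nrm (x - x'))); last first.
  by apply: ler_wpM2r; rewrite ?nrm_ge0 //; lra.
apply: le_trans (nrmD _ _) _; rewrite expr2 !nrmM.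
have -> : r * (2 * M + K) * nrm (x - x') = nrm (x - x') * (2 * r) * M + r * (K * nrm (x - x')) by ring.
apply: lerD.
  apply: ler_pM; rewrite ?mulr_ge0 ?nrm_ge0 //; last by apply: hM; lra.
  by apply: ler_wpM2l; rewrite ?nrm_ge0 //; apply: le_trans (nrmD _ _) _; lra.
apply: ler_pM; rewrite ?mulr_ge0 ?nrm_ge0 //; last by apply: hK; lra.
by have := nrm_ge0 (x' - y); nra.
Qed.

(** Up to the leading coefficient, [p.[z0] - w] is the product of the differences between [z0] and
    the roots of [p - w%:P], so they cannot all be at distance [r] or more. Algebraic closedness
    thus yields the local surjectivity of [p]. *)
Lemma root_near p (w z0 : C) (r : R) : (1 < size p)%N -> 0 <= r ->
  nrm (p.[z0] - w) < nrm (lead_coef p) * r ^+ (size p).-1 ->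
  exists2 y, p.[y] = w & nrm (y - z0) < r.
Proof.
move=> sp r0 h; pose q := p - w%:P.
have sq : size q = size p.
  by rewrite size_polyDl // size_polyN (leq_ltn_trans (size_polyC_leq1 _)).
have lq : lead_coef q = lead_coef p.
  by rewrite lead_coefDl // size_polyN (leq_ltn_trans (size_polyC_leq1 _)).
have [s qs] := closed_field_poly_normal q; rewrite lq in qs.
have l0 : lead_coef p != 0 by rewrite lead_coef_eq0 -size_poly_eq0; case: (size p) sp.
have ss : (size p).-1 = size s by rewrite -sq qs size_scale // size_prod_XsubC.
have [/hasP[y ys hy]|/hasPn far] := boolP (has (fun y => nrm (y - z0) < r) s).
  exists y => //; apply/eqP; rewrite -subr_eq0.
  have : root q y by rewrite qs rootZ // root_prod_XsubC.
  by rewrite /root hornerD hornerN hornerC.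
exfalso; move: h; apply/negP; rewrite -leNgt ss.
have -> : p.[z0] - w = q.[z0] by rewrite hornerD hornerN hornerC.
rewrite qs hornerZ nrmM ler_wpM2l ?nrm_ge0 // horner_prod nrm_prod.
elim: s far {qs ss} => [|y s IH] far; first by rewrite big_nil.
rewrite big_cons exprS; apply: ler_pM => //; first by rewrite exprn_ge0.
  by rewrite hornerXsubC nrmB leNgt far ?mem_head.
by apply: IH => x xs; rewrite far // inE xs orbT.
Qed.

Lemma contin01P f : contin01 f <-> (forall t, 0 <= t <= 1 -> forall e, 0 < e ->
  exists2 d, 0 < d & forall s, 0 <= s <= 1 -> `|s - t| < d -> nrm (f s - f t) < e).
Proof.
split=> h t t01 e e0.
  have [d [d0 hd]] := h t t01 e e0; exists d => // s s01 /(hd s s01).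
  by rewrite normr_ltC.
have [d d0 hd] := h t t01 e e0; exists d; split=> // s s01 st.
by rewrite normr_ltC; exact: hd.
Qed.

Lemma contin01_lip (f : R -> C) (K : R) :
  (forall s t, nrm (f s - f t) <= K * `|s - t|) -> contin01 f.
Proof.
move=> fK; apply/contin01P => t t01 e e0; exists (e / (`|K| + 1)).
  by rewrite divr_gt0 // ltr_wpDl.
move=> s _; rewrite ltr_pdivlMr ?ltr_wpDl // => h; apply: le_lt_trans (fK s t) _.
by apply: le_lt_trans h; have := ler_norm K; have := normr_ge0 (s - t); nra.
Qed.

Lemma contin01_rev f : contin01 f -> contin01 (fun t => f (1 - t)).
Proof.
move=> /contin01P cf; apply/contin01P => t t01 e e0.
have [|d d0 hd] := cf (1 - t) _ e e0; first by apply/andP; split; lra.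
exists d => // s s01 st; apply: hd; first by apply/andP; split; lra.
have -> : 1 - s - (1 - t) = t - s by ring.
by rewrite distrC.
Qed.

Definition path_cat f g (t : R) : C := if t <= 1 / 2 then f (2 * t) else g (2 * t - 1).

Lemma contin01_cat f g : contin01 f -> contin01 g -> f 1 = g 0 -> contin01 (path_cat f g).
Proof.
move=> /contin01P cf /contin01P cg fg; apply/contin01P => t t01 e e0; rewrite /path_cat.
have [lt|gt|eq] := ltgtP t (1 / 2).
- have [|d d0 hd] := cf (2 * t) _ e e0; first by apply/andP; split; lra.
  exists (Num.min (d / 2) (1 / 2 - t)) => [|s s01].
    by rewrite lt_min divr_gt0 // subr_gt0.
  rewrite lt_min !ltr_norml => /andP[/andP[h1 h2] /andP[h3 h4]].
  have -> : s <= 1 / 2 by lra.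
  by apply: hd; rewrite ?ltr_norml; apply/andP; split; lra.
- have [|d d0 hd] := cg (2 * t - 1) _ e e0; first by apply/andP; split; lra.
  exists (Num.min (d / 2) (t - 1 / 2)) => [|s s01].
    by rewrite lt_min divr_gt0 // subr_gt0.
  rewrite lt_min !ltr_norml => /andP[/andP[h1 h2] /andP[h3 h4]].
  have -> : (s <= 1 / 2) = false by apply/negbTE; rewrite -ltNge; lra.
  by apply: hd; rewrite ?ltr_norml; apply/andP; split; lra.
have [|d1 d10 h1] := cf 1 _ e e0; first by rewrite ler01 lexx.
have [|d2 d20 h2] := cg 0 _ e e0; first by rewrite ler01 lexx.
have e1 : 2 * t = 1 by rewrite eq; field.
exists (Num.min d1 d2 / 2) => [|s s01]; first by rewrite divr_gt0 // lt_min d10.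
have [m1 m2] : Num.min d1 d2 <= d1 /\ Num.min d1 d2 <= d2 by rewrite !ge_min !lexx orbT.
rewrite e1 ltr_norml => /andP[h3 h4]; have [s2|s2] := leP s (1 / 2).
  by apply: h1; rewrite ?ltr_norml; apply/andP; split; lra.
by rewrite fg; apply: h2; rewrite ?ltr_norml; apply/andP; split; lra.
Qed.

(** Agreement of the lifts is locally constant in [t]: at a common noncritical point [poly_bilip]
    forces agreement nearby, and distinct values stay apart by continuity. *)
Lemma unique_lifting p (gamma f g : R -> C) :
  contin01 f -> contin01 g ->
  (forall t, 0 <= t <= 1 -> ~ crit_val p (gamma t)) ->
  (forall t, 0 <= t <= 1 -> p.[f t] = gamma t) ->
  (forall t, 0 <= t <= 1 -> p.[g t] = gamma t) ->
  f 0 = g 0 -> f 1 = g 1.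
Proof.
move=> /contin01P cf /contin01P cg ncr pf pg.
apply: (@locally_const01 R (fun t => f t = g t)) => t t01.
have [fg|fg] := eqVneq (f t) (g t).
  have d0 : p^`().[f t] != 0.
    by apply/eqP => h; apply: (ncr t t01); exists (f t); split; rewrite ?pf.
  have [r r0 hr] := poly_bilip d0.
  have [d1 d10 h1] := cf t t01 r r0; have [d2 d20 h2] := cg t t01 r r0.
  exists (Num.min d1 d2) => [|s s01]; first by rewrite lt_min d10.
  rewrite lt_min => /andP[s1 s2]; split=> // _.
  have := hr _ _ (h1 s s01 s1); rewrite {1}fg => /(_ _ (h2 s s01 s2)).
  rewrite pf // pg // subrr nrm0 pmulr_rle0 ?divr_gt0 ?nrm_gt0 // => h.
  by apply/eqP; rewrite -subr_eq0 -nrm_eq0 eq_le h nrm_ge0.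
pose e := nrm (f t - g t) / 2.
have e0 : 0 < e by rewrite divr_gt0 // nrm_gt0 subr_eq0.
have [d1 d10 h1] := cf t t01 e e0; have [d2 d20 h2] := cg t t01 e e0.
exists (Num.min d1 d2) => [|s s01]; first by rewrite lt_min d10.
rewrite lt_min => /andP[s1 s2]; split=> [E|E]; last by rewrite E eqxx in fg.
have := h1 s s01 s1; have := h2 s s01 s2; rewrite E => k1; rewrite nrmB => k2.
by exfalso; have := nrm_tri (f t) (g s) (g t); move: k1 k2; rewrite /e; lra.
Qed.

End Paths.

(** * Monodromy *)

Section Monodromy.
Variable R : realType.
Local Notation C := R[i].
Local Notation nrm := (@ComplexField.Normc.normc R).
Implicit Types (r s t d e : R) (x y z w : C).

Lemma noncrit_roots (p : {poly C}) w : (1 < size p)%N -> ~ crit_val p w ->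
  exists rs, [/\ uniq rs, size rs = (size p).-1 & forall z, (z \in rs) = (p.[z] == w)].
Proof.
move=> sp ncr; pose q := p - w%:P.
have sq : size q = size p.
  by rewrite size_polyDl // size_polyN (leq_ltn_trans (size_polyC_leq1 _)).
have q0 : q != 0 by rewrite -size_poly_gt0 sq; case: (size p) sp.
have [rs qs] := closed_field_poly_normal q.
have l0 : lead_coef q != 0 by rewrite lead_coef_eq0.
have mem z : (z \in rs) = (p.[z] == w).
  rewrite -root_prod_XsubC -(rootZ _ _ l0) -qs /root hornerD hornerN hornerC.
  by rewrite subr_eq0.
exists rs; split=> //; last by rewrite -sq qs size_scale // size_prod_XsubC.
rewrite -separable_prod_XsubC -(eqp_separable (eqp_scale _ l0)) -qs separable_poly.unlock.
apply/coprimepP => u uq uq'; apply/negPn/negP => su.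
have [|z rz] := closed_rootP u _; first by rewrite size_poly_eq1.
apply: ncr; exists z; split.
  by have /rootP := root_dvdp uq' rz; rewrite derivB derivC subr0.
by have /rootP/eqP := root_dvdp uq rz; rewrite hornerD hornerN hornerC subr_eq0 => /eqP.
Qed.

Lemma crit_val_finite (p : {poly C}) : (1 < size p)%N ->
  exists cv : seq C, forall w, crit_val p w <-> w \in cv.
Proof.
move=> sp; have [rs e] := closed_field_poly_normal (p^`()).
have l0 : lead_coef p^`() != 0.
  by rewrite lead_coef_eq0 -size_poly_eq0 size_derivS; case: (size p) sp => [|[]].
exists [seq p.[c] | c <- rs] => w; split => [[c [c0 <-]]|/mapP[c crs ->]].
  by apply: map_f; rewrite -root_prod_XsubC -(rootZ _ _ l0) -e; apply/rootP.
by exists c; split=> //; apply/rootP; rewrite e rootZ // root_prod_XsubC.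
Qed.

Lemma fin_radius (I : finType) (Q : I -> R -> Prop) :
  (forall i r r', 0 < r' -> r' <= r -> Q i r -> Q i r') ->
  (forall i, exists2 r, 0 < r & Q i r) -> exists2 r, 0 < r & forall i, Q i r.
Proof.
move=> mono h; suff [r r0 hr] : exists2 r, 0 < r & forall i, i \in enum I -> Q i r.
  by exists r => // i; apply: hr; rewrite mem_enum.
elim: (enum I) => [|i s [r r0 IH]]; first by exists 1.
have [r' r'0 h'] := h i; have m0 : 0 < Num.min r r' by rewrite lt_min r0.
have [m1 m2] : Num.min r r' <= r /\ Num.min r r' <= r' by rewrite !ge_min !lexx orbT.
exists (Num.min r r') => // j; rewrite inE => /orP[/eqP ->|js].
  exact: mono m0 m2 h'.
exact: mono m0 m1 (IH j js).
Qed.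

Lemma near_notin (cv : seq C) w0 : w0 \notin cv -> nearby w0 (fun w => w \notin cv).
Proof.
elim: cv => [|v cv IH] h; first by exists 1.
move: h; rewrite inE negb_or => /andP[wv /IH h].
apply: near_imp (near_and (near_neq wv) h) => w [h1 h2]; rewrite inE negb_or h2 andbT.
rewrite -subr_eq0 -nrm_gt0; apply: lt_le_trans h1.
by rewrite divr_gt0 ?nrm_gt0 // subr_eq0.
Qed.

Section Covering.
Variables (p : {poly C}) (N : nat).
Hypotheses (sp : size p = N.+1) (N0 : (0 < N)%N).
Implicit Types (Y : 'I_N -> C).

(** Exhausting the fibre is not demanded: [N] is the degree of [p], so injectivity implies it
    ([fibre_all]). *)
Definition is_fibre w Y := injective Y /\ forall i, p.[Y i] = w.

Lemma fibre_all w Y z : is_fibre w Y -> p.[z] = w -> exists i, Y i = z.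
Proof.
move=> [injY pY] pz; have [/codomP[i e]|nz] := boolP (z \in codom Y); first by exists i.
pose rs := z :: codom Y.
have : (size rs < size (p - w%:P)%R)%N.
  have sq : size (p - w%:P) = size p.
    by rewrite size_polyDl // size_polyN (leq_ltn_trans (size_polyC_leq1 _)) // sp.
  apply: max_poly_roots; first by rewrite -size_poly_gt0 sq sp.
    apply/allP => x; rewrite inE => /orP[/eqP ->|/codomP[i ->]];
      by rewrite /root hornerD hornerN hornerC subr_eq0 ?pz ?pY.
  by rewrite /= nz; apply/injectiveP.
rewrite /= size_codom card_ord size_polyDl ?sp ?ltnn //.
by rewrite size_polyN (leq_ltn_trans (size_polyC_leq1 _)).
Qed.

Lemma fibre_perm w Y Y' : is_fibre w Y -> is_fibre w Y' ->
  exists s : 'S_N, forall i, Y' i = Y (s i).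
Proof.
move=> fY [injY' pY']; have [f hf] := choice (fun i => fibre_all fY (pY' i)).
have injf : injective f by move=> i j e; apply: injY'; rewrite -!hf e.
by exists (perm injf) => i; rewrite permE hf.
Qed.

Lemma fibre_exists w : ~ crit_val p w -> exists Y, is_fibre w Y.
Proof.
move=> ncr; have [|rs [us ss mem]] := noncrit_roots _ ncr; first by rewrite sp.
rewrite sp /= in ss; exists (fun i => nth 0 rs i); split=> [i j /eqP|i].
  by rewrite nth_uniq ?ss // => /eqP/val_inj.
by apply/eqP; rewrite -mem mem_nth // ss.
Qed.

(** The local sections of the covering. [root_near] provides them, [poly_bilip] makes them unique
    and Lipschitz, and separation of the discs around the [Y0 i] keeps them distinct. *)
Lemma local_branches w0 Y0 : ~ crit_val p w0 -> is_fibre w0 Y0 ->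
  exists d r L (br : C -> 'I_N -> C), [/\ 0 < d /\ 0 < r, br w0 = Y0,
    (forall w, nrm (w - w0) < d -> ~ crit_val p w /\ is_fibre w (br w)),
    (forall w w' i, nrm (w - w0) < d -> nrm (w' - w0) < d ->
       nrm (br w i - br w' i) <= L * nrm (w - w')) &
    (forall z i, nrm (p.[z] - w0) < d -> nrm (z - Y0 i) < r -> br p.[z] i = z)].
Proof.
move=> ncr [injY pY].
have lc0 : lead_coef p != 0 by rewrite lead_coef_eq0 -size_poly_eq0 sp.
(* The one number [r1] is both radius and expansion constant, so that a single minimum over the
   fibre suffices; its inverse is the Lipschitz constant [L]. *)
have [r1 r10 h1] : exists2 r, 0 < r & forall i x x',
    nrm (x - Y0 i) < r -> nrm (x' - Y0 i) < r -> r * nrm (x - x') <= nrm (p.[x] - p.[x']).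
  apply: fin_radius => [i r r' r'0 rr' h x x' hx hx'|i].
    apply: le_trans (h x x' (lt_le_trans hx rr') (lt_le_trans hx' rr')).
    by rewrite ler_wpM2r ?nrm_ge0.
  have a0 : p^`().[Y0 i] != 0.
    by apply/eqP => h; apply: ncr; exists (Y0 i).
  have [r r0 hr] := poly_bilip a0; pose b := nrm p^`().[Y0 i] / 2.
  have b0 : 0 < b by rewrite divr_gt0 // nrm_gt0.
  exists (Num.min r b) => [|x x']; first by rewrite lt_min r0.
  rewrite !lt_min => /andP[hx _] /andP[hx' _]; apply: le_trans (hr x x' hx hx').
  by rewrite ler_wpM2r ?nrm_ge0 // ge_min lexx orbT.
have [r2 r20 h2] : exists2 r, 0 < r & forall ij : 'I_N * 'I_N,
    ij.1 != ij.2 -> 2 * r <= nrm (Y0 ij.1 - Y0 ij.2).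
  apply: fin_radius => [ij r r' r'0 rr' h /h|[i j] /=]; first by lra.
  have [->|ij] := eqVneq i j; first by exists 1.
  exists (nrm (Y0 i - Y0 j) / 2) => [|_]; last by lra.
  by rewrite divr_gt0 // nrm_gt0 subr_eq0; apply: contraNneq ij => /injY ->.
pose r := Num.min r1 r2; have r0 : 0 < r by rewrite lt_min r10.
have [rr1 rr2] : r <= r1 /\ r <= r2 by rewrite !ge_min !lexx orbT.
have [cv hcv] : exists cv : seq C, forall w, crit_val p w <-> w \in cv.
  by apply: crit_val_finite; rewrite sp.
have [d1 d10 hd1] : nearby w0 (fun w => w \notin cv).
  by apply: near_notin; apply/negP => /hcv.
(* The first bound avoids critical values, the second is the one [root_near] asks for to find a root
   within [r]. *)
pose d := Num.min d1 (nrm (lead_coef p) * r ^+ N).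
have d0 : 0 < d by rewrite lt_min d10 mulr_gt0 ?nrm_gt0 // exprn_gt0.
have [dd1 dd2] : d <= d1 /\ d <= nrm (lead_coef p) * r ^+ N by rewrite !ge_min !lexx orbT.
have uniqr w i x x' : nrm (x - Y0 i) < r -> nrm (x' - Y0 i) < r -> p.[x] = w -> p.[x'] = w -> x = x'.
  move=> hx hx' px px'; have := h1 i x x' (lt_le_trans hx rr1) (lt_le_trans hx' rr1).
  rewrite px px' subrr nrm0 pmulr_rle0 // => h.
  by apply/eqP; rewrite -subr_eq0 -nrm_eq0 eq_le h nrm_ge0.
have ex (wi : C * 'I_N) : exists x, nrm (wi.1 - w0) < d -> p.[x] = wi.1 /\ nrm (x - Y0 wi.2) < r.
  case: wi => w i /=; have [h|h] := ltP (nrm (w - w0)) d; last by exists 0.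
  have [|||x px hx] := @root_near R p w (Y0 i) r; rewrite ?sp ?ltnS ?ltW //.
    by rewrite pY nrmB (lt_le_trans h).
  by exists x.
have [b hb] := choice ex; pose br w i := b (w, i).
have hbr w i : nrm (w - w0) < d -> p.[br w i] = w /\ nrm (br w i - Y0 i) < r := hb (w, i).
exists d, r, r1^-1, br; split=> //.
- apply/funext => i; have [|pb hbi] := hbr w0 i; first by rewrite subrr nrm0.
  by apply: (uniqr w0 i) => //; rewrite subrr nrm0.
- move=> w hw; split; first by move/hcv; apply/negP/hd1/(lt_le_trans hw).
  split=> [i j eij|i]; last by have [] := hbr w i hw.
  apply/eqP/negPn/negP => ij; have := h2 (i, j) ij => /=.
  have [_] := hbr w i hw; have [_] := hbr w j hw; rewrite eij => k1; rewrite nrmB => k2.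
  have := nrm_tri (Y0 i) (br w j) (Y0 j); move: k1 k2; rewrite [nrm (Y0 i - br w j)]nrmB; lra.
- move=> w w' i hw hw'; have [pw bw] := hbr w i hw; have [pw' bw'] := hbr w' i hw'.
  have := h1 i _ _ (lt_le_trans bw rr1) (lt_le_trans bw' rr1); rewrite pw pw'.
  by rewrite -ler_pdivlMl.
by move=> z i hz hzr; have [pb hbi] := hbr _ i hz; apply: (uniqr p.[z] i).
Qed.

End Covering.
End Monodromy.

(** * Transport of labelled fibres along paths *)

Section Transport.
Variable R : realType.
Local Notation C := R[i].
Local Notation nrm := (@ComplexField.Normc.normc R).
Implicit Types (r s t d e : R) (x y z w : C).
Variables (p : {poly C}) (N : nat).
Implicit Types (Y : 'I_N -> C).

(* [monodromy_perm p q lab s] unfolds to [transport q q lab (lab \o s)]. *)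
Definition transport w w' Y Y' := exists gamma : R -> C,
  [/\ contin01 gamma, gamma 0 = w, gamma 1 = w',
      (forall t, 0 <= t <= 1 -> ~ crit_val p (gamma t)) &
      forall i, exists lift : R -> C,
        [/\ contin01 lift, (forall t, 0 <= t <= 1 -> p.[lift t] = gamma t),
            lift 0 = Y i & lift 1 = Y' i]].

Lemma transport_refl w Y : ~ crit_val p w -> (forall i, p.[Y i] = w) -> transport w w Y Y.
Proof.
have cc (c : C) : contin01 (fun=> c).
  by apply: (@contin01_lip _ _ 0) => s t; rewrite subrr nrm0 mul0r.
move=> ncr pY; exists (fun=> w); split=> // i; exists (fun=> Y i); split=> //.
Qed.

Lemma transport_sym w w' Y Y' : transport w w' Y Y' -> transport w' w Y' Y.
Proof.
have r01 t : 0 <= t <= 1 -> 0 <= 1 - t <= 1 by move=> h; apply/andP; split; lra.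
move=> [g [cg g0 g1 ncr hl]]; exists (fun t => g (1 - t)).
rewrite subr0 subrr; split=> // [|t /r01/ncr//|i]; first exact: contin01_rev.
have [l [cl pl l0 l1]] := hl i; exists (fun t => l (1 - t)).
by rewrite subr0 subrr; split=> // [|t /r01/pl//]; exact: contin01_rev.
Qed.

Lemma transport_trans w w' w'' Y Y' Y'' :
  transport w w' Y Y' -> transport w' w'' Y' Y'' -> transport w w'' Y Y''.
Proof.
move=> [g [cg g0 g1 ncr hl]] [k [ck k0 k1 ncr' hl']].
have h0 : 0 <= 1 / 2 :> R by lra.
have h1 : (1 <= 1 / 2 :> R) = false by apply/negbTE; rewrite -ltNge; lra.
have c0 (f h : R -> C) : path_cat f h 0 = f 0.
  by rewrite /path_cat h0 mulr0.
have c1 (f h : R -> C) : path_cat f h 1 = h 1.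
  by rewrite /path_cat h1; congr h; ring.
exists (path_cat g k); split; rewrite ?c0 ?c1 //.
- by apply: contin01_cat; rewrite ?g1.
- move=> t t01; rewrite /path_cat; case: leP => ht; first by apply: ncr; apply/andP; split; lra.
  by apply: ncr'; apply/andP; split; lra.
move=> i; have [l [cl pl l0 l1]] := hl i; have [l' [cl' pl' l0' l1']] := hl' i.
exists (path_cat l l'); split; rewrite ?c0 ?c1 //; first by apply: contin01_cat; rewrite ?l1.
move=> t t01; rewrite /path_cat; case: leP => ht; first by apply: pl; apply/andP; split; lra.
by apply: pl'; apply/andP; split; lra.
Qed.

Lemma transport_perm (s : 'S_N) w w' Y Y' :
  transport w w' Y Y' -> transport w w' (Y \o s) (Y' \o s).
Proof. by move=> [g [cg g0 g1 ncr hl]]; exists g; split=> // i; exact: hl. Qed.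

(** Two lifts with the same endpoint are lifts from a common point when run backwards, so they had
    the same origin; hence the final labelling is again injective. *)
Lemma transport_fibre w w' Y Y' : is_fibre p w Y -> transport w w' Y Y' -> is_fibre p w' Y'.
Proof.
have r01 t : 0 <= t <= 1 -> 0 <= 1 - t <= 1 by move=> h; apply/andP; split; lra.
move=> [injY pY] [g [cg g0 g1 ncr hl]]; split=> [i j e|i].
  apply: injY; have [l [cl pl <- l1]] := hl i; have [l' [cl' pl' <- l1']] := hl j.
  rewrite -(subrr 1).
  apply: (@unique_lifting _ p (fun t => g (1 - t)) (fun t => l (1 - t)) (fun t => l' (1 - t))).
  - exact: contin01_rev.
  - exact: contin01_rev.
  - by move=> t /r01/ncr.
  - by move=> t /r01/pl.
  - by move=> t /r01/pl'.
  by rewrite subr0 l1 l1'.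
by have [l [cl pl l0 <-]] := hl i; rewrite pl ?g1 // ler01 lexx.
Qed.

Lemma transport_noncrit w w' Y Y' : transport w w' Y Y' -> ~ crit_val p w'.
Proof. by move=> [g [_ _ <- ncr _]]; apply: ncr; rewrite ler01 lexx. Qed.

Lemma transport_local w0 (d L : R) (br : C -> 'I_N -> C) w w' :
  (forall w, nrm (w - w0) < d -> ~ crit_val p w /\ is_fibre p w (br w)) ->
  (forall w w' i, nrm (w - w0) < d -> nrm (w' - w0) < d ->
     nrm (br w i - br w' i) <= L * nrm (w - w')) ->
  nrm (w - w0) < d -> nrm (w' - w0) < d -> transport w w' (br w) (br w').
Proof.
move=> hbr lip hw hw'.
pose g t := w + (t%:C)%C * (w' - w).
have g_lip s t : nrm (g s - g t) <= nrm (w' - w) * `|s - t|.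
  have -> : g s - g t = ((s - t)%:C)%C * (w' - w) by rewrite /g rmorphB; ring.
  by rewrite nrmM nrm_real mulrC.
have gd t : 0 <= t <= 1 -> nrm (g t - w0) < d.
  move=> t01; have -> : g t - w0 = ((1 - t)%:C)%C * (w - w0) + (t%:C)%C * (w' - w0).
    by rewrite /g rmorphB rmorph1; ring.
  apply: le_lt_trans (nrmD _ _) _; rewrite !nrmM !nrm_real.
  rewrite !ger0_norm; [|lra|lra].
  have [t0|t0] := eqVneq t 0; first by rewrite t0 mul0r subr0 mul1r addr0.
  have : t * nrm (w' - w0) < t * d by rewrite ltr_pM2l // lt_def t0; case/andP: t01.
  have : (1 - t) * nrm (w - w0) <= (1 - t) * d by rewrite ler_wpM2l //; lra.
  by lra.
have g0 : g 0 = w by rewrite /g mul0r addr0.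
have g1 : g 1 = w' by rewrite /g mul1r addrC subrK.
have cg : contin01 g by apply: contin01_lip g_lip.
exists g; split=> // [t /gd/hbr[]//|i].
exists (fun t => br (g t) i); rewrite g0 g1; split=> //.
  apply/contin01P => t t01 e e0; have M0 : 0 < `|L| + 1 by rewrite ltr_wpDl.
  have /contin01P/(_ t t01 (e / (`|L| + 1))) := cg; rewrite divr_gt0 // => -[//|c c0 hc].
  exists c => // s s01 sc; have := hc s s01 sc; rewrite ltr_pdivlMr // => h.
  apply: le_lt_trans (lip _ _ i (gd s s01) (gd t t01)) _.
  by apply: le_lt_trans h; have := nrm_ge0 (g s - g t); have := ler_norm L; nra.
by move=> t /gd/hbr[_ [_ ->]].
Qed.

Hypotheses (sp : size p = N.+1) (N0 : (0 < N)%N).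

Section Reach.
Variables (q : C) (lab : 'I_N -> C).
Hypotheses (q_noncrit : ~ crit_val p q) (lab_fibre : is_fibre p q lab).

Let reach w := exists Y, transport q w lab Y.

Lemma reach_local w0 : ~ crit_val p w0 -> exists2 d : R, 0 < d &
  forall w w', nrm (w - w0) < d -> nrm (w' - w0) < d -> reach w -> reach w'.
Proof.
move=> ncr; have [Y0 fY0] := fibre_exists sp N0 ncr.
have [d [r [L [br [[d0 r0] br0 hbr lip _]]]]] := local_branches sp N0 ncr fY0.
exists d => // w w' hw hw' [Y tY]; have fY := transport_fibre lab_fibre tY.
have [s hs] := fibre_perm sp N0 (hbr w hw).2 fY.
exists (br w' \o s); apply: transport_trans tY _.
have -> : Y = br w \o s by apply/funext.
exact/transport_perm/(transport_local hbr lip).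
Qed.

(** The segment from [q] to [w] may meet critical values, so it is bent into an arc
    [q + (w - q) * (t + i * c * t * (1 - t))]. Along an arc avoiding them, reachability is locally
    constant. *)
Lemma reach_all w : ~ crit_val p w -> reach w.
Proof.
move=> ncr; have rq : reach q by exists lab; apply: transport_refl => //; exact: lab_fibre.2.
have [->//|wq] := eqVneq w q.
have [cv hcv] : exists cv : seq C, forall w, crit_val p w <-> w \in cv.
  by apply: crit_val_finite; rewrite sp.
pose ratio v := (v - q) / (w - q).
(* The only [c] for which the arc can meet [v] at an interior time, which must be [Re (ratio v)].
   Finitely many critical values exclude finitely many [c]. *)
pose bad v := complex.Im (ratio v) / (complex.Re (ratio v) * (1 - complex.Re (ratio v))).
have [c hc] : exists c : R, c \notin [seq bad v | v <- cv].
  exists (1 + \sum_(b <- [seq bad v | v <- cv]) `|b|); apply/negP => h.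
  have s0 (l : seq R) : 0 <= \sum_(b <- l) `|b| by apply: sumr_ge0.
  have := erefl (\sum_(b <- [seq bad v | v <- cv]) `|b|).
  rewrite {1}(big_rem _ h) /= ger0_norm ?addr_ge0 ?s0 //.
  by have := s0 (rem (1 + \sum_(b <- [seq bad v | v <- cv]) `|b|) [seq bad v | v <- cv]); lra.
pose g t := q + (w - q) * Complex t (c * (t * (1 - t))).
have g0 : g 0 = q by rewrite /g mul0r mulr0 mulr0 addr0.
have g1 : g 1 = w by rewrite /g subrr !mulr0 mulr1 addrC subrK.
have wq0 : w - q != 0 by rewrite subr_eq0.
have gnc t : 0 <= t <= 1 -> ~ crit_val p (g t).
  move=> t01 /hcv gt; have [t0|t0] := eqVneq t 0.
    by apply: q_noncrit; apply/hcv; rewrite -g0 -t0.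
  have [t1|t1] := eqVneq t 1; first by apply: ncr; apply/hcv; rewrite -g1 -t1.
  move/negP: hc; apply; apply/mapP; exists (g t) => //.
  have -> : c = c * (t * (1 - t)) / (t * (1 - t)).
    by rewrite mulfK // mulf_neq0 // subr_eq0 eq_sym.
  have -> // : bad (g t) = c * (t * (1 - t)) / (t * (1 - t)).
  by rewrite /bad /ratio /g addrAC subrr add0r mulrAC divff // mul1r.
rewrite -g1; apply: (@locally_const01 R (fun t => reach (g t))); last by rewrite g0.
move=> t t01; have [d d0 hd] := reach_local (gnc t t01).
pose K := nrm (w - q) * (1 + `|c|); have K0 : 0 <= K by rewrite mulr_ge0 ?nrm_ge0 ?addr_ge0.
exists (d / (K + 1)) => [|s s01 st]; first by rewrite divr_gt0 // ltr_wpDl.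
have gs : nrm (g s - g t) < d.
  have -> : g s - g t = (w - q) * Complex (s - t) (c * ((s - t) * (1 - s - t))).
    transitivity ((w - q) * (Complex s (c * (s * (1 - s))) - Complex t (c * (t * (1 - t))))).
      by rewrite /g; ring.
    by congr (_ * _); apply/eqP; rewrite eq_complex /=; apply/andP; split; apply/eqP; ring.
  rewrite nrmM; apply: le_lt_trans (_ : K * `|s - t| < d); last first.
    by move: st; rewrite ltr_pdivlMr ?ltr_wpDl //; have := normr_ge0 (s - t); nra.
  rewrite /K -mulrA ler_wpM2l ?nrm_ge0 //; apply: le_trans (nrm_ReIm _) _ => /=.
  rewrite [leRHS]mulrDl mul1r lerD2l !normrM ler_wpM2l // ler_piMr // ler_norml.
  by apply/andP; split; lra.
have gt : nrm (g t - g t) < d by rewrite subrr nrm0.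
by split; apply: hd.
Qed.

End Reach.
End Transport.

(** * From blocks to decompositions *)

Section Decomposition.
Variable R : realType.
Local Notation C := R[i].
Local Notation nrm := (@ComplexField.Normc.normc R).
Implicit Types (r s t d e : R) (x y z w : C).

(** The Lipschitz bound makes [y z - y z0] of first order; feeding this back into the expansion of
    [p] at [y z0] inverts it up to third order. *)
Lemma branch_jet2 (p : {poly C}) (y : C -> C) z0 (L : R) :
  p^`().[y z0] != 0 ->
  nearby z0 (fun z => p.[y z] = p.[z]) ->
  nearby z0 (fun z => nrm (y z - y z0) <= L * nrm (z - z0)) -> jet2 y z0.
Proof.
set y0 := y z0 => a0 py lipy.
have [q1 e1] := poly_taylor1 p y0; have [q2 e2] := poly_taylor1 q1 y0.
have [q e3] := poly_taylor1 q2 y0.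
have da : p^`().[y0] = q1.[y0].
  rewrite {1}e1 derivD derivC add0r derivM derivXsubC mul1r hornerD hornerM hornerXsubC subrr.
  by rewrite mul0r addr0.
rewrite da in a0; set a := q1.[y0] in a0; pose b := q2.[y0].
have pE x : p.[x] = p.[y0] + (x - y0) * a + (x - y0) ^+ 2 * b + (x - y0) ^+ 3 * q.[x].
  by rewrite {1}e1 {1}e2 {1}e3 !(hornerXsubC, hornerD, hornerM, hornerC) -/a -/b; ring.
have [V eV] := poly_taylor1 p z0.
(* [eta] is bounded near [z0] by the Lipschitz hypothesis; at [z0] itself it is 0, the numerator
   being 0. *)
pose h z := y z - y0; pose eta z := h z / (z - z0).
have py0 : p.[y0] = p.[z0] := near_at py.
have h0 : h z0 = 0 by rewrite /h subrr.
have hE z : nrm (h z) <= L * nrm (z - z0) -> h z = (z - z0) * eta z.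
  move=> hz; rewrite /eta mulrC; have [->|zz0] := eqVneq z z0.
    by rewrite h0 !mul0r.
  by rewrite divfK // subr_eq0.
have beta : bdd_near z0 eta.
  exists `|L|; apply: near_imp lipy => z hz; rewrite /eta nrmM nrmV.
  have [->|zz0] := eqVneq z z0; first by rewrite h0 nrm0 mul0r.
  have zp : 0 < nrm (z - z0) by rewrite nrm_gt0 subr_eq0.
  rewrite ler_pdivrMr //; apply: le_trans hz _.
  by rewrite ler_wpM2r ?ler_norm // ltW.
have bq : bdd_near z0 (fun z => q.[y z]).
  have [M [d d0 hM]] := bdd_poly y0 q; have [d' d'0 hd'] := lipy.
  have L0 : 0 < `|L| + 1 by rewrite ltr_wpDl.
  exists M, (Num.min d' (d / (`|L| + 1))) => [|z]; first by rewrite lt_min d'0 divr_gt0.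
  rewrite lt_min ltr_pdivlMr // => /andP[/hd' h1 h2]; apply: hM; apply: le_lt_trans h1 _.
  by have := nrm_ge0 (z - z0); have := ler_norm L; nra.
have bh : bdd_near z0 h.
  by exists (`|L| + 1); have [d' d'0 hd'] := lipy; exists (Num.min d' 1) => [|z];
     [rewrite lt_min d'0 /=|rewrite lt_min => /andP[/hd' h1 h2];
      apply: le_trans h1 _; have := nrm_ge0 (z - z0); have := ler_norm L; have := normr_ge0 L; nra].
have bc (c : C) : bdd_near z0 (fun=> c) by exists (nrm c), 1.
pose W : {poly C} := p - p.[z0]%:P.
pose theta z := - a^-1 * (eta z * eta z * (b + h z * q.[y z])).
(* Reversion of [W = a * h + b * h ^+ 2 + ...], namely [h = W / a - b * W ^+ 2 / a ^+ 3 + ...]. Here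
   [theta] is the bounded quotient of [h - W / a] by [(z - z0) ^+ 2]. *)
exists (y0%:P + a^-1 *: W - (b * a^-1 ^+ 3) *: W ^+ 2).
exists (fun z => - (b / a) * (theta z * (eta z + a^-1 * V.[z])) - a^-1 * (eta z * eta z * eta z * q.[y z])).
split.
  have bdN (f : C -> C) : bdd_near z0 f -> bdd_near z0 (fun z => - f z).
    by move=> [M hM]; exists M; apply: near_imp hM => z; rewrite nrmN.
  have bt : bdd_near z0 theta by repeat (apply: bddM || apply: bddD) => //; apply: bc.
  apply: bddD; last apply: bdN.
    by repeat (apply: bddM || apply: bddD) => //; (exact: bdd_poly || exact: bc).
  by repeat apply: bddM => //; apply: bc.
apply: near_imp (near_and py lipy) => z [pz /hE hz].
have WE : W.[z] = (z - z0) * V.[z].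
  by rewrite /W hornerD hornerN hornerC {1}eV hornerD hornerM hornerC hornerXsubC; ring.
have E : (z - z0) * V.[z] = h z * a + h z ^+ 2 * b + h z ^+ 3 * q.[y z].
  by rewrite -WE /W hornerD hornerN hornerC -pz pE py0 -/(h z); ring.
have tE : (z - z0) ^+ 2 * theta z = h z - a^-1 * ((z - z0) * V.[z]).
  transitivity (- a^-1 * (((z - z0) * eta z) ^+ 2 * (b + h z * q.[y z]))).
    by rewrite /theta; ring.
  by rewrite -hz E; field.
clearbody W; rewrite !(hornerD, hornerN, hornerZ, hornerC, horner_exp) WE.
have {1}-> : y z = y0 + h z by rewrite addrC subrK.
set T := (z - z0) ^+ 3 * _.
have -> : T = - (b / a) * (((z - z0) ^+ 2 * theta z) * ((z - z0) * eta z + a^-1 * ((z - z0) * V.[z]))) -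
    a^-1 * (((z - z0) * eta z) ^+ 3 * q.[y z]).
  by rewrite /T; ring.
rewrite tE -hz E; move: (h z) (q.[y z]) a0 => u v a0; field; exact: a0.
Qed.

(** If [z'] were much larger than [z], the leading term of [p.[z']] would exceed both the rest of
    [p.[z']] and [p.[z]]. *)
Lemma fibre_growth (p : {poly C}) : (1 < size p)%N ->
  exists2 K, 0 <= K & forall z z', p.[z] = p.[z'] -> nrm z' <= K * (1 + nrm z).
Proof.
move=> sp; case ep : (size p) sp => [|[|n]] // _.
have l0 : 0 < nrm (lead_coef p) by rewrite nrm_gt0 lead_coef_eq0 -size_poly_eq0 ep.
have [K K0 hK] := poly_growth p; rewrite ep /= in hK.
pose p1 := p - lead_coef p *: 'X^(n.+1).
have [K1 K10 hK1] : exists2 K1, 0 <= K1 & forall z, nrm p1.[z] <= K1 * (1 + nrm z) ^+ n.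
  have [K1 K10 hK1] := poly_growth p1; exists K1 => // z; apply: le_trans (hK1 z) _.
  apply: ler_wpM2l => //; apply: ler_weXn2l; first by rewrite lerDl nrm_ge0.
  have : (size p1 <= n.+1)%N.
    apply/leq_sizeP => j; rewrite coefB coefZ coefXn leq_eqVlt => /orP[/eqP <-|nj].
      by rewrite eqxx mulr1 lead_coefE ep subrr.
    by rewrite gtn_eqF // mulr0 subr0 nth_default // ep.
  by case: (size p1).
(* The summand 1 ensures [1 + nrm z <= nrm z'] in the case refuted; then [1 + nrm z' <= 2 * nrm z'],
   which produces the factor [2 ^+ n]. *)
pose M := (K + 2 ^+ n * K1) / nrm (lead_coef p) + 1.
have M0 : 0 <= (K + 2 ^+ n * K1) / nrm (lead_coef p).
  by apply: divr_ge0; [rewrite addr_ge0 // mulr_ge0 // exprn_ge0|exact: ltW].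
exists M => [|z z' pz]; first by rewrite addr_ge0.
have nz := nrm_ge0 z; have nz' := nrm_ge0 z'.
rewrite leNgt; apply/negP => big.
have zz' : 1 + nrm z <= nrm z'.
  by apply: le_trans _ (ltW big); rewrite ler_peMl //; rewrite ?lerDr //; lra.
have h1 : nrm p.[z'] <= K * nrm z' ^+ n * (1 + nrm z).
  rewrite -pz; apply: le_trans (hK z) _; rewrite exprS [(1 + _) * _]mulrC mulrA.
  apply: ler_wpM2r; first lra.
  by apply: ler_wpM2l => //; apply: lerXn2r; rewrite ?nnegrE; lra.
have h2 : nrm p1.[z'] <= 2 ^+ n * K1 * nrm z' ^+ n * 1.
  apply: le_trans (hK1 z') _; rewrite mulr1 mulrAC -exprMn mulrC.
  by apply: ler_wpM2r => //; apply: lerXn2r; rewrite ?nnegrE; lra.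
have h3 : nrm (lead_coef p) * nrm z' ^+ n * nrm z' <= nrm p.[z'] + nrm p1.[z'].
  have -> : nrm (lead_coef p) * nrm z' ^+ n * nrm z' = nrm (p.[z'] - p1.[z']).
    by rewrite -mulrA -exprSr -nrmX -nrmM /p1 !(hornerD, hornerN, hornerZ, hornerXn) opprB addrC subrK.
  by apply: le_trans (nrmD _ _) _; rewrite nrmN.
have zn : 0 < nrm z' ^+ n by apply: exprn_gt0; lra.
have h4 : nrm (lead_coef p) * nrm z' <= (K + 2 ^+ n * K1) * (1 + nrm z).
  rewrite -(ler_pM2r zn).
  have k2 : 0 <= 2 ^+ n * K1 * nrm z' ^+ n by rewrite !mulr_ge0 // exprn_ge0.
  have : 2 ^+ n * K1 * nrm z' ^+ n * 1 <= 2 ^+ n * K1 * nrm z' ^+ n * (1 + nrm z).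
    by rewrite ler_wpM2l //; lra.
  by move: h1 h2 h3; lra.
move: big; rewrite /M mulrDl mul1r => big.
have : nrm (lead_coef p) * ((K + 2 ^+ n * K1) / nrm (lead_coef p) * (1 + nrm z)) =
   (K + 2 ^+ n * K1) * (1 + nrm z).
  by field; rewrite gt_eqF.
have := ltr_pM2l l0 ((K + 2 ^+ n * K1) / nrm (lead_coef p) * (1 + nrm z)) (nrm z').
move=> h5 h6; have : nrm (lead_coef p) * ((K + 2 ^+ n * K1) / nrm (lead_coef p) * (1 + nrm z)) <
   nrm (lead_coef p) * nrm z' by rewrite h5; lra.
by rewrite h6; lra.
Qed.

(** Expansion of [p] in powers of [g]: [p - p.[z0]%:P] vanishes on a full fibre of [g], so [g -
    g.[z0]%:P] divides it, and the quotient is again constant on fibres of [g]. Only on the fibre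
    divided out is this unknown, so its points join [s]. *)
Lemma comp_of_constant_on_fibres (F : fieldType) (p g : {poly F}) (k : nat) (s : seq F) :
  (forall t : seq F, exists z : F, z \notin t) -> size g = k.+2 ->
  (forall z : F, z \notin s -> exists rs, [/\ uniq rs, size rs = k.+1, z \in rs &
     forall x : F, x \in rs -> g.[x] = g.[z] /\ p.[x] = p.[z]]) ->
  exists h, p = h \Po g.
Proof.
move=> inf sg; have [n] := ubnP (size p); elim: n p s => // n IH p s sp hs.
have [sp1|sp1] := leqP (size p) 1.
  by exists p; rewrite (size1_polyC sp1) comp_polyC.
have [z0 z0s] := inf s; have [rs [us ss z0rs hrs]] := hs z0 z0s.
pose g0 := g - g.[z0]%:P.
have sg0 : size g0 = k.+2.
  by rewrite size_polyDl // size_polyN (leq_ltn_trans (size_polyC_leq1 _)) // sg.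
have g0E : g0 = lead_coef g0 *: \prod_(x <- rs) ('X - x%:P).
  apply: all_roots_prod_XsubC; rewrite ?sg0 ?ss //; last by rewrite uniq_rootsE.
  by apply/allP => x /hrs[gx _]; rewrite /root hornerD hornerN hornerC gx subrr.
have l0 : lead_coef g0 != 0 by rewrite lead_coef_eq0 -size_poly_eq0 sg0.
have mem (x : F) : (x \in rs) = (g.[x] == g.[z0]).
  rewrite -root_prod_XsubC -(rootZ _ _ l0) -g0E /root hornerD hornerN hornerC.
  by rewrite subr_eq0.
have [p1 ep1] : exists p1, p - p.[z0]%:P = p1 * g0.
  apply/dvdpP; rewrite g0E dvdpZl //; apply: uniq_roots_dvdp; last by rewrite uniq_rootsE.
  by apply/allP => x /hrs[_ px]; rewrite /root hornerD hornerN hornerC px subrr.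
have pE (x : F) : p.[x] - p.[z0] = p1.[x] * (g.[x] - g.[z0]).
  by have := congr1 (horner^~ x) ep1; rewrite !(hornerM, hornerD, hornerN, hornerC).
have [|z zs|h eh] := IH p1 (s ++ rs).
- have [->|p10] := eqVneq p1 0; first by rewrite size_poly0; case: n sp {IH} => //; lia.
  have : size (p - p.[z0]%:P) = size p.
    by rewrite size_polyDl // size_polyN (leq_ltn_trans (size_polyC_leq1 _)).
  rewrite ep1 size_mul //; last by rewrite -size_poly_eq0 sg0.
  by rewrite sg0 !addnS /= => e; move: sp; rewrite -e !ltnS; apply: leq_ltn_trans; rewrite leq_addr.
- move: zs; rewrite mem_cat negb_or mem => /andP[/hs[rs' [us' ss' zrs' hrs']] gz].
  exists rs'; split=> // x /hrs'[gx px]; split=> //.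
  have gx0 : g.[z] - g.[z0] != 0 by rewrite subr_eq0.
  by apply: (mulIf gx0); rewrite -pE -px -gx -pE.
exists (p.[z0]%:P + h * ('X - g.[z0]%:P)).
rewrite comp_polyD comp_polyC comp_polyM comp_polyB comp_polyX comp_polyC -eh.
by rewrite -/g0 -ep1 addrC subrK.
Qed.

End Decomposition.

(** * The polynomial attached to a system of blocks *)

Section Blocks.
Local Notation pblock := finset.pblock.
Variable R : realType.
Local Notation C := R[i].
Local Notation nrm := (@ComplexField.Normc.normc R).
Implicit Types (r t d e : R) (x y z w : C).

Lemma crit_preimage_finite (p : {poly C}) : (1 < size p)%N ->
  exists s : seq C, forall z, z \in s <-> crit_val p p.[z].
Proof.
move=> sp; have [cv hcv] := crit_val_finite sp.
pose Q : {poly C} := \prod_(v <- cv) (p - v%:P).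
have Q0 : Q != 0.
  rewrite prodf_seq_neq0; apply/allP => v _ /=; rewrite -size_poly_gt0 size_polyDl.
    exact: ltnW.
  by rewrite size_polyN (leq_ltn_trans (size_polyC_leq1 _)).
have [s eQ] := closed_field_poly_normal Q; exists s => z.
rewrite hcv -root_prod_XsubC -(rootZ _ _ (_ : lead_coef Q != 0)) ?lead_coef_eq0 // -eQ.
rewrite /root horner_prod prodf_seq_eq0; split=> [/hasP[v vs]|zc].
  by rewrite hornerD hornerN hornerC subr_eq0 => /eqP ->.
by apply/hasP; exists p.[z]; rewrite // hornerD hornerN hornerC subrr eqxx.
Qed.

Variables (p : {poly C}) (N : nat).
Hypotheses (sp : size p = N.+1) (N0 : (0 < N)%N).
Variables (q : C) (lab : 'I_N -> C).
Hypotheses (q_noncrit : ~ crit_val p q) (lab_fibre : is_fibre p q lab).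
Variables (Pt : {set {set 'I_N}}) (k : nat).
Hypotheses (Pt_part : finset.partition Pt [set: 'I_N]) (Pt_card : forall B, B \in Pt -> #|B| = k.+1).
Hypothesis Pt_inv : forall s : 'S_N, monodromy_perm p q lab s ->
  forall B : {set 'I_N}, B \in Pt -> [set s i | i in B] \in Pt.

Let sp1 : (1 < size p)%N. Proof. by rewrite sp. Qed.
Let tI : finset.trivIset Pt. Proof. by case/and3P: Pt_part. Qed.

Let in_block i : i \in pblock Pt i.
Proof. by rewrite finset.mem_pblock; case/and3P: Pt_part => /eqP -> _ _; rewrite inE. Qed.

Let block_in i : pblock Pt i \in Pt.
Proof. by rewrite finset.pblock_mem //; case/and3P: Pt_part => /eqP -> _ _; rewrite inE. Qed.

Let block_inv s i : monodromy_perm p q lab s -> pblock Pt (s i) = [set s j | j in pblock Pt i].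
Proof. by move=> ms; apply: finset.def_pblock => //; [exact: Pt_inv|exact: imset_f]. Qed.

Definition block_value x0 (Y : 'I_N -> C) i := \prod_(j in pblock Pt i) (x0 - Y j).

Lemma block_value_unique x0 w Y Y' i i' :
  transport p q w lab Y -> transport p q w lab Y' -> Y i = Y' i' ->
  block_value x0 Y i = block_value x0 Y' i'.
Proof.
move=> tY tY' e; have fY := transport_fibre lab_fibre tY.
have [s hs] := fibre_perm sp N0 fY (transport_fibre lab_fibre tY').
have -> : i = s i' by apply: fY.1; rewrite e hs.
(* [s] is the monodromy of the loop that goes out along the path of [tY'] and returns along that of
   [tY]; being a monodromy permutation, it maps blocks to blocks. *)
have ms : monodromy_perm p q lab s.
  apply: transport_sym; apply: transport_trans (transport_perm s tY) _.
  have -> : Y \o s = Y' by apply/funext => j; rewrite /= -hs.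
  exact: transport_sym.
rewrite /block_value block_inv // big_imset; last by move=> j j' _ _; exact: perm_inj.
by apply: eq_bigr => j _; rewrite hs.
Qed.

Lemma block_function x0 : exists f : C -> C,
  forall w Y i, transport p q w lab Y -> f (Y i) = block_value x0 Y i.
Proof.
have ex z : exists v, ~ crit_val p p.[z] ->
    exists Y i, [/\ transport p q p.[z] lab Y, Y i = z & v = block_value x0 Y i].
  (* On critical fibres the value is an arbitrary 0; these finitely many points are the exceptional
     ones for Liouville's theorem. *)
  have [cr|ncr] := pselect (crit_val p p.[z]); first by exists 0.
  have [Y tY] := reach_all sp N0 q_noncrit lab_fibre ncr.
  have [i Yi] := fibre_all sp N0 (transport_fibre lab_fibre tY) (erefl p.[z]).
  by exists (block_value x0 Y i) => _; exists Y, i.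
have [f hf] := choice ex; exists f => w Y i tY.
have [_ pY] := transport_fibre lab_fibre tY.
have [|Y' [i' [tY' e ->]]] := hf (Y i); first by rewrite pY; exact: transport_noncrit tY.
by apply: block_value_unique tY' _ e; rewrite pY.
Qed.

Lemma block_function_jet2 x0 f z0 :
  (forall w Y i, transport p q w lab Y -> f (Y i) = block_value x0 Y i) ->
  ~ crit_val p p.[z0] -> jet2 f z0.
Proof.
move=> fE ncr; have [Y0 tY0] := reach_all sp N0 q_noncrit lab_fibre ncr.
have fY0 := transport_fibre lab_fibre tY0.
have [i Yi] := fibre_all sp N0 fY0 (erefl p.[z0]).
have [d [r [L [br [[d0 r0] br0 hbr lip loc]]]]] := local_branches sp N0 ncr fY0.
have [K [d1 d10 hK]] := jet2_lip (jet2_poly p z0).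
have near_d : nearby z0 (fun z => nrm (p.[z] - p.[z0]) < d).
  have K0 : 0 < `|K| + 1 by rewrite ltr_wpDl.
  exists (Num.min d1 (d / (`|K| + 1))) => [|z]; first by rewrite lt_min d10 divr_gt0.
  rewrite lt_min ltr_pdivlMr // => /andP[/hK h1 h2]; apply: le_lt_trans h1 _.
  by have := nrm_ge0 (z - z0); have := ler_norm K; nra.
have d00 : nrm (p.[z0] - p.[z0]) < d by rewrite subrr nrm0.
have jb j : jet2 (fun z => br p.[z] j) z0.
  apply: (@branch_jet2 R p (fun z => br p.[z] j) z0 (`|L| * K)).
  - by apply/eqP => h; apply: ncr; exists (br p.[z0] j); rewrite br0 (fY0.2 j) -br0.
  - by apply: near_imp near_d => z /hbr[_ []].
  apply: near_imp (near_and near_d (ex_intro2 _ _ d1 d10 hK)) => z [hz h].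
  apply: le_trans (lip _ _ j hz d00) _; rewrite -mulrA.
  apply: (@le_trans _ _ (`|L| * nrm (p.[z] - p.[z0]))); last exact: ler_wpM2l.
  by apply: ler_wpM2r; [exact: nrm_ge0|exact: ler_norm].
have jprod : jet2 (fun z => block_value x0 (br p.[z]) i) z0.
  apply: jet2_prod => j.
  have := jet2D (jet2_poly x0%:P z0) (jet2M (jet2_poly (-1) z0) (jb j)).
  by apply: eq_jet2; exists 1 => // z _; rewrite hornerC hornerN hornerC mulN1r.
apply: eq_jet2 jprod.
have near_r : nearby z0 (fun z => nrm (z - Y0 i) < r) by exists r; rewrite // Yi.
apply: near_imp (near_and near_d near_r) => z [hz hr].
(* [z] is the value of branch [i] at [p.[z]], and a path to [p.[z0]] extended inside the disc
   carries [lab] to the branches there, so [fE] applies. *)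
rewrite -{2}(loc z i hz hr); apply/esym/(fE p.[z]).
by apply: transport_trans tY0 _; rewrite -br0; exact: (transport_local hbr lip).
Qed.

Lemma block_function_growth x0 f :
  (forall w Y i, transport p q w lab Y -> f (Y i) = block_value x0 Y i) ->
  exists K, forall z, ~ crit_val p p.[z] -> nrm (f z) <= K * (1 + nrm z) ^+ k.+1.
Proof.
move=> fE; have [K K0 hK] := fibre_growth sp1; exists ((nrm x0 + K) ^+ k.+1) => z ncr.
have [Y tY] := reach_all sp N0 q_noncrit lab_fibre ncr.
have fY := transport_fibre lab_fibre tY.
have [i Yi] := fibre_all sp N0 fY (erefl p.[z]).
rewrite -{1}Yi (fE _ _ _ tY) /block_value nrm_prod -exprMn.
rewrite -(Pt_card (block_in i)) -prodr_const; apply: ler_prod => j _.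
rewrite nrm_ge0 /=; apply: le_trans (nrmD _ _) _; rewrite nrmN mulrDl; apply: lerD.
  by rewrite ler_peMr ?nrm_ge0 // lerDl nrm_ge0.
by apply: hK; rewrite fY.2.
Qed.

Lemma block_decomposition : (1 < #|Pt|)%N ->
  exists g h : {poly C}, size g = k.+2 /\ p = h \Po g.
Proof.
(* With [x0] in the base fibre, [g] vanishes at the [k.+1] points of its block, which bounds the
   degree from below once [g != 0]; a point of a second block, available by [1 < #|Pt|], shows
   that. *)
move=> Pt1; pose i0 : 'I_N := Ordinal N0; pose x0 := lab i0.
have [f fE] := block_function x0.
have [s hs] := crit_preimage_finite sp1.
have [K fK] := block_function_growth fE.
have [|z /negP zs|g sg fg] := @liouville R k.+1 f s K.
- by move=> z /negP zs; apply: (block_function_jet2 fE) => /hs.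
- by apply: fK => /hs.
have gE w Y i : transport p q w lab Y -> g.[Y i] = block_value x0 Y i.
  move=> tY; rewrite -(fE _ _ _ tY) fg //; apply/negP => /hs.
  by rewrite (transport_fibre lab_fibre tY).2; exact: transport_noncrit tY.
have tq : transport p q q lab lab by apply: transport_refl => //; exact: lab_fibre.2.
have [i1 hi1] : exists i, i \notin pblock Pt i0.
  apply/existsP; rewrite -[[exists _, _]]negbK negb_exists; apply/negP => /forallP h.
  have PtE : Pt \subset [set pblock Pt i0].
    apply/fintype.subsetP => B BP; rewrite inE; have /finset.set0Pn[i iB] : B != finset.set0.
      by rewrite -card_gt0 (Pt_card BP).
    have := h i; rewrite negbK => ib; rewrite -(finset.def_pblock tI BP iB).
    by rewrite eq_sym; apply/eqP/esym/finset.same_pblock.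
  by have := subset_leq_card PtE; rewrite cards1 leqNgt Pt1.
have g0 : g != 0.
  apply/eqP => g0; have := gE _ _ i1 tq; rewrite g0 horner0 => /esym/eqP.
  apply/negP; apply/prodf_neq0 => j ji; rewrite subr_eq0.
  apply: contra hi1 => /eqP/lab_fibre.1 e; move: ji; rewrite -e => ji.
  by rewrite (finset.same_pblock tI ji).
have size_g : size g = k.+2.
  apply: anti_leq; rewrite sg /=.
  have := @max_poly_roots _ g [seq lab j | j <- enum (pblock Pt i0)] g0.
  rewrite size_map -cardE Pt_card //; apply.
    apply/allP => y /mapP[j]; rewrite mem_enum => ji ->; rewrite /root (gE _ _ _ tq).
    apply/prodf_eq0; exists i0; last by rewrite subrr.
    by rewrite (finset.same_pblock tI ji) in_block.
  by rewrite map_inj_uniq ?enum_uniq //; exact: lab_fibre.1.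
exists g; have [z zs|h eh] := @comp_of_constant_on_fibres _ p g k s (@exists_notin R) size_g; last by exists h.
have ncr : ~ crit_val p p.[z] by move/hs => zs'; rewrite zs' in zs.
have [Y tY] := reach_all sp N0 q_noncrit lab_fibre ncr.
have fY := transport_fibre lab_fibre tY.
have [i Yi] := fibre_all sp N0 fY (erefl p.[z]).
exists [seq Y j | j <- enum (pblock Pt i)]; split.
- by rewrite map_inj_uniq ?enum_uniq //; exact: fY.1.
- by rewrite size_map -cardE Pt_card.
- by rewrite -Yi map_f // mem_enum.
move=> y /mapP[j]; rewrite mem_enum => ji ->; split; last exact: fY.2.
by rewrite -Yi !(gE _ _ _ tY) /block_value (finset.same_pblock tI ji).
Qed.

End Blocks.

(** * Blocks from a decomposition, and the equivalence *)

Section Imprimitive.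
Variable R : realType.
Local Notation C := R[i].
Local Notation nrm := (@ComplexField.Normc.normc R).
Local Notation pblock := finset.pblock.
Implicit Types (r t d e : R) (x y z w : C).

Lemma contin01_poly (g : {poly C}) (f : R -> C) : contin01 f -> contin01 (fun t => g.[f t]).
Proof.
move=> /contin01P cf; apply/contin01P => t t01 e e0.
have [K [d d0 hd]] := jet2_lip (jet2_poly g (f t)).
have K0 : 0 < `|K| + 1 by rewrite ltr_wpDl.
have m0 : 0 < Num.min d (e / (`|K| + 1)) by rewrite lt_min d0 divr_gt0.
have [c c0 hc] := cf t t01 _ m0; exists c => // s s01 /(hc s s01).
rewrite lt_min ltr_pdivlMr // => /andP[/hd h1 h2]; apply: le_lt_trans h1 _.
by have := nrm_ge0 (f s - f t); have := ler_norm K; nra.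
Qed.

Variables (F g : {poly C}).

Lemma crit_val_comp_inner w : crit_val g w -> crit_val (F \Po g) F.[w].
Proof.
move=> [c [c0 <-]]; exists c; rewrite horner_comp; split=> //.
by rewrite deriv_comp hornerM c0 mulr0.
Qed.

Lemma crit_val_comp_outer w : (1 < size g)%N -> crit_val F w -> crit_val (F \Po g) w.
Proof.
move=> sg [c [c0 <-]].
have [z gz] : exists z, g.[z] = c.
  have [|z /eqP] := @closed_rootP _ (g - c%:P) _.
    by rewrite size_polyDl ?size_polyN ?(leq_ltn_trans (size_polyC_leq1 _)) // gtn_eqF.
  by rewrite hornerD hornerN hornerC => /eqP; rewrite subr_eq0 => /eqP; exists z.
exists z; rewrite horner_comp gz; split=> //.
by rewrite deriv_comp hornerM horner_comp gz c0 mul0r.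
Qed.

Lemma imprimitive_of_comp (N l k : nat) (q : C) (lab : 'I_N -> C) :
  size g = k.+2 -> N = (l * k.+1)%N ->
  ~ crit_val (F \Po g) q -> fibre_labelling (F \Po g) q lab ->
  imprimitive l (monodromy_perm (F \Po g) q lab).
Proof.
move=> sg eN ncr [injlab [plab hlab]].
have sg1 : (1 < size g)%N by rewrite sg.
pose rl := [rel i j : 'I_N | g.[lab i] == g.[lab j]].
have eqr : {in [set: 'I_N] & &, equivalence_rel rl}.
  by move=> a b c _ _ _; split => /=; rewrite ?eqxx // => /eqP ->.
pose Pt := equivalence_partition rl [set: 'I_N].
have part : finset.partition Pt [set: 'I_N] := equivalence_partitionP eqr.
have tI : finset.trivIset Pt by case/and3P: part.
have cov i : i \in finset.cover Pt by case/and3P: part => /eqP -> _ _; rewrite inE.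
have mem i j : (j \in pblock Pt i) = (g.[lab i] == g.[lab j]).
  by rewrite pblock_equivalence_partition ?inE.
have blk B : B \in Pt -> exists i, B = pblock Pt i.
  move=> BP; have /finset.set0Pn[i iB] : B != finset.set0.
    by case/and3P: part => _ _; apply: contraNneq => <-.
  by exists i; rewrite (finset.def_pblock tI BP iB).
(* The block of [i] labels the whole fibre of [g] through [lab i]: it lies over [q], and it has
   [k.+1] points because a critical value of [g] there would make [q] critical. *)
have card i : #|pblock Pt i| = k.+1.
  have ncr' : ~ crit_val g g.[lab i].
    by move/crit_val_comp_inner; rewrite -horner_comp plab.
  have [rs [us ss hrs]] := noncrit_roots sg1 ncr'; rewrite sg /= in ss.
  rewrite -ss cardE -(size_map lab); apply: perm_size; apply: uniq_perm => //.
    by rewrite map_inj_uniq ?enum_uniq.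
  move=> z; rewrite hrs; apply/mapP/eqP => [[j]|gz].
    by rewrite mem_enum mem => /eqP -> ->.
  have [j jz] : exists j, lab j = z by apply: hlab; rewrite horner_comp gz -horner_comp.
  by exists j; rewrite // mem_enum mem jz gz.
have cardPt : #|Pt| = l.
  have unif : {in Pt, forall B : {set 'I_N}, #|B| = k.+1} by move=> B /blk[i ->].
  have := card_uniform_partition unif part; rewrite cardsT card_ord => h; have := etrans (esym h) eN => /eqP.
  by rewrite eqn_pmul2r // => /eqP ->.
split; first by rewrite eN dvdn_mulr.
exists Pt; split=> //.
  move=> B /blk[i ->]; rewrite card eN mulKn //.
  by have := ltn_ord i; rewrite [X in (_ < X)%N]eN; case: (l).
move=> s [gamma [cgam gam0 gam1 ncg hl]] B /blk[i ->].
have -> : [set s j | j in pblock Pt i] = pblock Pt (s i).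
  apply/eqP; rewrite eqEcard card_imset ?card //; last exact: perm_inj.
  rewrite leqnn andbT; apply/fintype.subsetP => x /finset.imsetP[j ji ->]; rewrite mem; apply/eqP.
  have [f [cf pf f0 f1]] := hl i; have [f' [cf' pf' f0' f1']] := hl j.
  rewrite -f1 -f1'.
  (* Composed with [g], lifts of [gamma] through [F \Po g] become lifts through [F]; those starting
     at one point end at one point. *)
  apply: (@unique_lifting _ F gamma (fun t => g.[f t]) (fun t => g.[f' t])).
  - exact: contin01_poly.
  - exact: contin01_poly.
  - by move=> t t01 /(crit_val_comp_outer sg1); exact: ncg.
  - by move=> t t01; rewrite -horner_comp pf.
  - by move=> t t01; rewrite -horner_comp pf'.
  by rewrite f0 f0'; apply/eqP; rewrite -mem.
by rewrite finset.pblock_mem ?cov.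
Qed.

End Imprimitive.

Theorem theorem6p2 (R : realType) (d n m : nat) (D A B : {poly R[i]})
  (q : R[i]) (lab : 'I_(2 * n) -> R[i]) :
  (2 <= d)%N -> sqfree D -> size D = (2 * d).+1 ->
  is_pell_sol D A B -> size A = n.+1 ->
  ~ crit_val (A ^+ 2) q -> fibre_labelling (A ^+ 2) q lab ->
  (0 < m)%N -> (m %| n)%N -> (d <= n %/ m)%N ->
  (is_pell_power D A B m <->
   imprimitive (2 * m) (monodromy_perm (A ^+ 2) q lab)).

Proof.
move=> d2 sqD sD sol sA ncr fib m0 mn dk.
have [n0 kE] : (0 < n)%N /\ n = (m * (n %/ m))%N.
  by split; [have := leq_trans d2 dk; case: (n); rewrite ?div0n|rewrite mulnC divnK].
have [k ek] : exists k, (n %/ m = k.+1)%N by exists (n %/ m).-1; rewrite prednK // (leq_trans _ dk) // ltnW.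
rewrite ek in kE dk.
have A0 : A != 0 by rewrite -size_poly_gt0 sA.
have sA2 : size (A ^+ 2) = (2 * n).+1 by rewrite expr2 size_mul // sA; lia.
have N0 : (0 < 2 * n)%N by rewrite muln_gt0.
split=> [[A' [B' [[pe' B'0] [s1 [s2 [eA eB]]]]]]|[_ [Pt [part cardPt cardB inv]]]].
  rewrite (pell_pow_comp s2 m pe') /= in eA.
  pose T := (cheb R[i] s2 m).1.
  (* The square removes the outer sign. The outer factor [T ^+ 2] has degree [2 * m], the number of
     blocks, and the inner factor is [A']. *)
  have A2 : A ^+ 2 = (T ^+ 2) \Po A'.
    by rewrite eA exprMn sqrr_sign mul1r rmorphXn.
  have sA' : size A' = k.+2.
    have : size A = size (T \Po A').
      by rewrite eA; case: (s1); rewrite ?expr0 ?expr1 ?mul1r // mulN1r size_polyN.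
    rewrite sA; case E : (size A') => [|[|b]].
    - by move/eqP: E; rewrite size_poly_eq0 => /eqP ->; rewrite comp_poly0r size_polyC; case: (n) n0 => // n' _; case: (_ != 0).
    - by rewrite (size1_polyC (eq_leq E)) comp_polyCr size_polyC; case: (n) n0 => // n' _; case: (_ != 0).
    rewrite (@size_compS _ _ _ m b) ?size_cheb // => -[] /eqP.
    by rewrite kE eqn_pmul2l // => /eqP [->].
  rewrite A2 in ncr fib *; apply: (imprimitive_of_comp (k := k)) => //.
  by rewrite kE mulnA.
have card' B1 : B1 \in Pt -> #|B1| = k.+1.
  by move/cardB ->; rewrite divnMl // ek.
have isf : is_fibre (A ^+ 2) q lab by case: fib => iY [pY _]; split.
(* There are [2 * m] blocks, hence at least two even when [m = 1]. *)
have [|g [h [sg eh]]] := block_decomposition sA2 N0 ncr isf part card' inv.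
  by rewrite cardPt; move: m0; clear; lia.
apply: (@pell_power_of_comp _ d m k.+1 D A B g h) => //; first exact: leq_trans dk.
have := size_comp_poly h g; rewrite -eh sA2 sg /= kE mulnA => /eqP.
rewrite eqn_pmul2r // => /eqP e.
by rewrite e prednK // lt0n; apply/eqP => h0; move: e m0; rewrite h0; case: (m).
Qed.
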